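(* Let $n\geq 2$, $t\in[0,1]$ and \[ \mu_{0}= \frac{(3-2n)t+1-2n+\sqrt{(1-t)[(4n-5)t+4n^2-4n+1]} }{2(n-1)^2}. \] Let $\mu\in\mathbb{R}\setminus[\mu_0,-t/n]$ with $n+1+2t+(n-1)\mu\neq 0$. Then there is no $\underline{\xi}\in\mathbb{R}^n$ (with $1,\xi_1,\ldots,\xi_n$ linearly independent over $\mathbb{Q}$) such that \[ \overline{\varphi}_{n+1}=t, \qquad \underline{\varphi}_{n+1}=(1-n)\frac{t+n\mu }{n+1+2t+(n-1)\mu}, \qquad \underline{\varphi}_{1}=\mu. \] Equivalently, no $\underline{\xi}$ has $\overline{\varphi}_{n+1}=t$, $\underline{\varphi}_{1}=\mu$ and equality in $n\underline{\varphi}_{1} +\overline{\varphi}_{n+1} \leq -\underline{\varphi}_{n+1}\left(\frac{n+1}{n-1}+\underline{\varphi}_{1}+\frac{2}{n-1}\overline{\varphi}_{n+1} \right)$.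
   Context: For $\underline{\xi}=(\xi_1,\ldots,\xi_n)\in\mathbb{R}^n$ with $\{1,\xi_1,\ldots,\xi_n\}$ linearly independent over $\mathbb{Q}$ and $q>0$, let $K(q)\subseteq\mathbb{R}^{n+1}$ be the box $|z_0|\leq e^{nq}$, $\max_{1\le i\le n}|z_i|\leq e^{-q}$, and $\Lambda_{\underline{\xi}}=\{(x,\xi_1x-y_1,\ldots,\xi_nx-y_n): x,y_i\in\mathbb{Z}\}$. Let $\lambda_1(q)\le\cdots\le\lambda_{n+1}(q)$ be the successive minima of $K(q)$ w.r.t. $\Lambda_{\underline{\xi}}$, $\varphi_j(q)=\log\lambda_j(q)/q$, $\underline{\varphi}_j=\liminf_{q\to\infty}\varphi_j(q)$, $\overline{\varphi}_j=\limsup_{q\to\infty}\varphi_j(q)$. *)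

(* Defs.v *)
From HB Require Import structures.
From mathcomp Require Import all_boot all_order all_algebra.
From mathcomp Require Import all_classical all_reals all_analysis.
Set Implicit Arguments. Unset Strict Implicit. Unset Printing Implicit Defensive.
Import Order.TTheory GRing.Theory Num.Theory.
Local Open Scope classical_set_scope.
Local Open Scope ring_scope.

Section Defs.
Variable R : realType.

Definition Q_lin_indep (n : nat) (xi : 'I_n -> R) : Prop :=
  forall (a0 : rat) (a : 'I_n -> rat),
    ratr a0 + \sum_(i < n) ratr (a i) * xi i = 0 ->
    a0 = 0 /\ forall i, a i = 0.

Definition lattice_pt (n : nat) (xi : 'I_n -> R) (x : int) (y : 'I_n -> int)
  : R * ('I_n -> R) := (x%:~R, fun i => xi i * x%:~R - (y i)%:~R).

Definition in_box (n : nat) (q l : R) (z : R * ('I_n -> R)) : Prop :=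
  `|z.1| <= l * expR (n%:R * q) /\ forall i, `|z.2 i| <= l * expR (- q).

Definition lin_indep (j n : nat) (v : 'I_j -> R * ('I_n -> R)) : Prop :=
  forall c : 'I_j -> R,
    \sum_(k < j) c k * (v k).1 = 0 ->
    (forall i, \sum_(k < j) c k * (v k).2 i = 0) ->
    forall k, c k = 0.

Definition succ_min (n : nat) (xi : 'I_n -> R) (q : R) (j : nat) : R :=
  inf [set l : R | 0 < l /\
        exists (x : 'I_j -> int) (y : 'I_j -> 'I_n -> int),
          lin_indep (fun k => lattice_pt xi (x k) (y k)) /\
          forall k, in_box q l (lattice_pt xi (x k) (y k))].

Definition phi (n : nat) (xi : 'I_n -> R) (j : nat) (q : R) : R :=
  ln (succ_min xi q j) / q.

Definition is_liminf_pinfty (f : R -> R) (l : R) : Prop :=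
  (forall e, 0 < e -> exists Q, forall q, Q < q -> l - e < f q) /\
  (forall e, 0 < e -> forall Q, exists q, Q < q /\ f q < l + e).

Definition is_limsup_pinfty (f : R -> R) (l : R) : Prop :=
  (forall e, 0 < e -> exists Q, forall q, Q < q -> f q < l + e) /\
  (forall e, 0 < e -> forall Q, exists q, Q < q /\ l - e < f q).

End Defs.

(* Main.v *)
(** Pass to the dual lattice: [phi_{n+1}(q)] is, up to [O(1/q)], minus the exponent of the shortest
    integer linear form [y], measured by [e^{nq} |form y| + e^{-q} height y].  At a peak [p] of
    the last minimum, of height close to [t], take the short form [y]; it stays good up to
    about [q = p (n+t)/(n+th)], where [th] is the prescribed lower limit, and after that a form
    [y'] independent of [y] takes over.  Minkowski's linear forms theorem turns [d] independent
    forms into a short lattice point orthogonal to all of them, so that [phi_1 >= mu]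
    bounds the products of their sizes from below.  The prescribed value of [th] makes this bound
    sharp for [y, y'], which forbids good forms in the plane of [y, y'] of height beyond
    [e^{(1-th)q}]; as [phi_{n+1} <= t], that plane stops containing good forms at a time
    [s <= (1-th)(n+t)^2 / ((1-t)(n+th)^2) p].  The bound for [y, y'] and the next form [z]
    gives [s >= (1-mu)/(1-th) p].  Comparing the two is a quadratic inequality in [mu] that
    amounts to [mu >= mu0], while [mu <= -t/n] is the bound for [y] alone. *)
Require Import Defs.
From HB Require Import structures.
From mathcomp Require Import all_boot all_order all_algebra.
From mathcomp Require Import all_classical all_reals all_analysis.
From mathcomp Require Import perm ring lra zify.
Import Order.TTheory GRing.Theory Num.Theory.
Import numFieldNormedType.Exports.
Local Open Scope ring_scope.

Set Implicit Arguments.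
Unset Strict Implicit.
Unset Printing Implicit Defensive.

(** * Minkowski's linear forms theorem, up to a constant *)

(** The bound for the plane of [y, y'] cannot come from the product of the sizes at [p] of two late
    forms [u, v] spanning it: that product grows with their heights, and the coordinates of [u /\ v]
    built from two height entries are not controlled by form values. The way out is that [y] lies in
    the plane, and that at its peak its form coordinate is, up to [e^{O(eps p)}], as large as the
    whole vector. Wedging [y] with the combination of [u, v] whose form vanishes bounds all of
    [u /\ v] by coordinates containing a form value. To keep this comparison exact, [p] is defined
    by [|form y| = e^{-(n+t)p}]. Two requirements fall on the time at which the plane is left; for
    the prescribed [th] they coincide as the error exponent vanishes, so one ratio serves both. The
    cases [th = 0] and [t = 1], outside the reach of the peak argument, are settled by algebra at
    the threshold. *)

Lemma diag_residue_collision (N B : nat) (e : 'I_N -> nat)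
    (f : {ffun 'I_N -> 'I_B.+1} -> 'I_N -> int) :
  (forall j, (0 < e j)%N) -> (\prod_j e j < B.+1 ^ N)%N ->
  exists w w', w != w' /\ forall j, ((e j)%:Z %| f w j - f w' j)%Z.
Proof.
move=> e0 eB.
(* The index [(e j).-1.+1] equals [e j] and makes the residue type visibly nonempty, as [inord]
   requires. *)
pose g (w : {ffun 'I_N -> 'I_B.+1}) :
  {dffun forall j : 'I_N, 'I_(e j).-1.+1} :=
  [ffun j => inord `|(f w j %% (e j)%:Z)%Z|%N].
have ng : ~ injective g.
  move=> /leq_card; rewrite card_ffun !card_ord leqNgt => /negP; apply.
  rewrite card_dep_ffun foldrE big_map big_enum /=.
  by rewrite (eq_bigr e) // => j _; rewrite card_ord prednK.
have [w [w' [gw ww']]] : exists w w', g w = g w' /\ w != w'.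
  apply: contrapT => H; apply: ng => w w' gw.
  by apply/eqP; apply/negPn/negP => ww'; apply: H; exists w, w'.
exists w, w'; split=> // j.
have /(congr1 val) := congr1 (fun h : {dffun forall j : 'I_N, 'I_(e j).-1.+1} => h j) gw.
rewrite !ffunE /=.
have ej : (e j)%:Z != 0 by rewrite eqz_nat -lt0n.
have mlt x : (`|(x %% (e j)%:Z)%Z| < (e j).-1.+1)%N.
  by rewrite prednK // -ltz_nat gez0_abs ?modz_ge0 // ltz_mod.
rewrite !inordK // => /eqP; rewrite -eqz_nat !gez0_abs ?modz_ge0 //.
by rewrite eqz_mod_dvd.
Qed.

(* Two points of the cube [0, B]^N are congruent modulo the lattice spanned by the rows of
   [A]; the Smith normal form counts the [|det A|] residue classes. *)
Lemma int_matrix_short_vector (N B : nat) (A : 'M[int]_N) :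
  \det A != 0 -> (`|\det A|%N < B.+1 ^ N)%N ->
  exists2 x : 'rV[int]_N, x != 0 & forall j, `|(x *m A) 0 j| <= B%:Z.
Proof.
have [L Lu [P Pu [d _ ->]]] := int_Smith_normal_form A.
have detu (M : 'M[int]_N) : M \in unitmx -> `|\det M|%N = 1%N.
  by rewrite unitmxE => /orP[] /eqP ->.
have Ddiag : (\matrix_(i < N, j < N) (d`_i *+ (i == j :> nat)))
    = diag_mx (\row_j d`_j).
  by apply/matrixP => i j; rewrite !mxE.
rewrite Ddiag !det_mulmx det_diag !abszM (detu L) // (detu P) // mul1n muln1.
move=> D0 DB.
have d0 (j : 'I_N) : (0 < `|(d`_j)%R|)%N.
  rewrite absz_gt0; apply: contra_neq D0 => dj.
  by rewrite (bigD1 j) //= mxE dj mul0r mulr0 mul0r.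
have DB' : (\prod_(j < N) `|(d`_j)%R| < B.+1 ^ N)%N.
  by move: DB; rewrite (big_morph absz abszM absz1); under eq_bigr do rewrite mxE.
pose toV (w : {ffun 'I_N -> 'I_B.+1}) : 'rV[int]_N := \row_j (w j : nat)%:Z.
pose f w (j : 'I_N) := (toV w *m invmx P) 0 j.
have [w [w' [ww' dv]]] := @diag_residue_collision _ _ _ f d0 DB'.
(* The quotients satisfy [y D = (w - w') P^-1], so [x = y L^-1] has [x A = w - w'], whose entries
   are differences of numbers in [[0, B]]. *)
pose y : 'rV[int]_N := \row_j (((f w j - f w' j) %/ d`_j)%Z).
have yD : y *m diag_mx (\row_j d`_j) = (toV w - toV w') *m invmx P.
  apply/rowP => j; rewrite mul_mx_diag [LHS]mxE [X in X * _]mxE [X in _ * X]mxE divzK.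
    by rewrite mulmxBl [RHS]mxE [X in _ = _ + X]mxE.
  exact: dv.
exists (y *m invmx L).
  apply: contra_neq ww' => yL0.
  have y0 : y = 0 by rewrite -(mulmxKV Lu y) yL0 mul0mx.
  have : toV w - toV w' = 0 by rewrite -(mulmxKV Pu (_ - _)) -yD y0 !mul0mx.
  move/eqP; rewrite subr_eq0 => /eqP e; apply/ffunP => j; apply/val_inj.
  by have := congr1 (fun v : 'rV[int]_N => v 0 j) e; rewrite !mxE => -[].
move=> j; rewrite !mulmxA mulmxKV // yD mulmxKV // !mxE.
rewrite ler_norml; case: (w j) (w' j) => a ha [b hb] /=; clear -ha hb; lia.
Qed.

Section ShortVectors.
Variable R : realType.

Definition intv (N : nat) (x : 'rV[int]_N) : 'rV[R]_N := map_mx intr x.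

Definition nrm1 (N : nat) (v : 'rV[R]_N) : R := \sum_j `|v 0 j|.

Lemma nrm1_ge0 N (v : 'rV[R]_N) : 0 <= nrm1 v.
Proof. by apply: sumr_ge0. Qed.

Lemma nrm1_coord N (v : 'rV[R]_N) j : `|v 0 j| <= nrm1 v.
Proof. by rewrite /nrm1 (bigD1 j) //= lerDl sumr_ge0. Qed.

Lemma nrm1D N (u v : 'rV[R]_N) : nrm1 (u + v) <= nrm1 u + nrm1 v.
Proof.
by rewrite /nrm1 -big_split ler_sum // => j _; rewrite mxE ler_normD.
Qed.

Lemma nrm1Z N c (v : 'rV[R]_N) : nrm1 (c *: v) = `|c| * nrm1 v.
Proof. by rewrite /nrm1 mulr_sumr; apply: eq_bigr => j _; rewrite mxE normrM. Qed.

Lemma nrm1_sum N (I : Type) (r : seq I) (P : pred I) (F : I -> 'rV[R]_N) :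
  nrm1 (\sum_(i <- r | P i) F i) <= \sum_(i <- r | P i) nrm1 (F i).
Proof.
apply: (big_ind2 (fun u c => nrm1 u <= c)) => //.
  by rewrite /nrm1 big1 // => j _; rewrite mxE normr0.
by move=> u c v d uc vd; apply: le_trans (nrm1D _ _) _; exact: lerD.
Qed.

Lemma nrm1_eq0 N (v : 'rV[R]_N) : (nrm1 v == 0) = (v == 0).
Proof.
apply/eqP/eqP => [v0|->]; last by rewrite /nrm1 big1 // => j _; rewrite mxE normr0.
apply/rowP => j; rewrite mxE; apply/eqP; rewrite -normr_le0.
by rewrite -v0 nrm1_coord.
Qed.

Lemma nrm1_le N (v : 'rV[R]_N) c : (forall j, `|v 0 j| <= c) -> nrm1 v <= N%:R * c.
Proof.
move=> vc; apply: (le_trans (ler_sum _ (fun j _ => vc j))).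
by rewrite sumr_const card_ord mulr_natl.
Qed.

Lemma nrm1_delta N (k : 'I_N) : nrm1 (delta_mx 0 k : 'rV[R]_N) = 1.
Proof.
rewrite /nrm1 (bigD1 k) //= mxE !eqxx normr1 big1 ?addr0 // => j jk.
by rewrite mxE (negPf jk) andbF normr0.
Qed.

Lemma nrm1_mul_bounded N M (A : 'M[R]_(N, M)) :
  exists2 K, 0 < K & forall v : 'rV[R]_N, nrm1 (v *m A) <= K * nrm1 v.
Proof.
exists (1 + \sum_i nrm1 (row i A)).
  by rewrite ltr_wpDr // sumr_ge0 // => i _; exact: nrm1_ge0.
move=> v; rewrite mulmx_sum_row; apply: le_trans (nrm1_sum _ _ _) _.
apply: (@le_trans _ _ (\sum_i nrm1 v * nrm1 (row i A))).
  by apply: ler_sum => i _; rewrite nrm1Z ler_wpM2r ?nrm1_ge0 ?nrm1_coord.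
by rewrite -mulr_sumr mulrC ler_wpM2r ?nrm1_ge0 // lerDr.
Qed.

Lemma intv_inj N : injective (@intv N).
Proof.
move=> x y /rowP xy; apply/rowP => j.
by have := xy j; rewrite !mxE => /intr_inj.
Qed.

Lemma intv0 N : intv (0 : 'rV_N) = 0.
Proof. exact: map_mx0. Qed.

Lemma intv_eq0 N (x : 'rV[int]_N) : (intv x == 0) = (x == 0).
Proof. by rewrite -intv0 (inj_eq (@intv_inj N)). Qed.

Lemma det_approx N (M : 'M[R]_N) :
  ((\det (\matrix_(i, j) ((Num.floor (m%:R * M i j))%:~R / m%:R) : 'M[R]_N) : R)
    @[m --> \oo] --> \det M)%classic.
Proof.
rewrite /determinant.
apply: cvg_big => [|s _]; first exact: add_continuous.
apply: cvgM; first exact: cvg_cst.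
apply: cvg_big => [|i _]; first exact: mul_continuous.
under eq_cvg do rewrite mxE.
set a := M i _.
apply: (@squeeze_cvgr _ _ _ _ (fun m : nat => a - m%:R^-1) (fun=> a)).
- near=> m; have m0 : (0 < m)%N by near: m; exists 1%N.
  have m0' : 0 < m%:R :> R by rewrite ltr0n.
  apply/andP; rewrite ler_pdivrMr // ler_pdivlMr // mulrBl mulVf ?gt_eqF //.
  have := floor_itv (m%:R * a) => /andP[h1 h2].
  rewrite intrD in h2; split; rewrite [a * _]mulrC //.
  by rewrite lerBlDr ltW.
- rewrite -[X in (_ --> X)%classic]subr0; apply: cvgB; first exact: cvg_cst.
  apply/gtr0_cvgV0; last exact: cvgr_idn.
  by exists 1%N => // m /= m0; rewrite ltr0n.
- exact: cvg_cst.
Unshelve. all: by end_near. Qed.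

(** The integer lemma with cube side [m] is applied to [floor (m M)], whose determinant is below
    [m^N] for large [m]. Rounding costs [nrm1 x / m] per coordinate, at most 1 once [m] exceeds an a
    priori bound for [x]; hence 2 in place of Minkowski's 1. *)
Lemma linear_forms_short N (M : 'M[R]_N) :
  M \in unitmx -> `|\det M| < 1 ->
  exists2 x : 'rV[int]_N, x != 0 & forall j, `|(intv x *m M) 0 j| <= 2.
Proof.
move=> Mu M1.
have dM0 : \det M != 0 by rewrite -unitfE -unitmxE.
have [K K0 HK] := nrm1_mul_bounded (invmx M).
pose A m : 'M[int]_N := \matrix_(i, j) Num.floor (m%:R * M i j).
have [m [m0 mK Adet Alt]] : exists m : nat, [/\ (0 < m)%N,
    2 * N%:R * K <= m%:R, \det (A m) != 0 & (`|\det (A m)| < m.+1 ^ N)%N].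
  have cv := @det_approx N M.
  have detA m : (0 < m)%N -> \det (\matrix_(i, j) ((Num.floor (m%:R * M i j))%:~R / m%:R) : 'M[R]_N)
      = (\det (A m))%:~R / m%:R ^+ N.
    move=> m0; rewrite -det_map_mx /= mulrC -exprVn -detZ.
    by congr (\det _); apply/matrixP => i j; rewrite !mxE mulrC.
  have n1 : \forall m \near \oo%classic, \det (\matrix_(i, j) ((Num.floor (m%:R * M i j))%:~R / m%:R) : 'M[R]_N) != 0.
    exact: (cvgr_neq0 _ cv).
  have n2 : \forall m \near \oo%classic, `|\det (\matrix_(i, j) ((Num.floor (m%:R * M i j))%:~R / m%:R) : 'M[R]_N)| < 1.
    exact: (cvgr_norm_lt _ cv).
  have n3 : \forall m \near \oo%classic, 2 * N%:R * K <= m%:R by exact: nbhs_infty_ger.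
  have n4 : \forall m \near \oo%classic, (0 < m)%N by exists 1%N.
  near \oo%classic => m.
  have m0 : (0 < m)%N by near: m.
  exists m; split => //.
  - by near: m.
  - have : \det (\matrix_(i, j) ((Num.floor (m%:R * M i j))%:~R / m%:R) : 'M[R]_N) != 0 by near: m.
    by rewrite detA //; apply: contra_neq => ->; rewrite mul0r.
  - have : `|\det (\matrix_(i, j) ((Num.floor (m%:R * M i j))%:~R / m%:R) : 'M[R]_N)| < 1 by near: m.
    rewrite detA // normrM normfV (ger0_norm (exprn_ge0 _ _)) // ltr_pdivrMr ?exprn_gt0 ?ltr0n // mul1r.
    rewrite -intr_norm -natrX -[(m ^ N)%:R]/((m ^ N)%:Z%:~R) ltr_int -abszE ltz_nat => h.
    by apply: leq_trans h _; case: (N) => // k; rewrite leq_exp2r.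
have [x x0 xA] := int_matrix_short_vector Adet Alt.
exists x => //.
have m0' : 0 < m%:R :> R by rewrite ltr0n.
have key j : `|(intv x *m M) 0 j| <= 1 + nrm1 (intv x) / m%:R.
  rewrite -(ler_pM2r m0') mulrDl divfK ?gt_eqF // mul1r.
  rewrite -[X in _ * X]ger0_norm // -normrM.
  have -> : (intv x *m M) 0 j * m%:R = (intv x *m map_mx intr (A m)) 0 j
     + \sum_k intv x 0 k * (m%:R * M k j - (A m k j)%:~R).
    rewrite !mxE mulr_suml -big_split; apply: eq_bigr => k _ /=.
    by rewrite !mxE; ring.
  apply: le_trans (ler_normD _ _) (lerD _ _).
    rewrite -map_mxM mxE -intr_norm.
    by rewrite -[m%:R]/(m%:Z%:~R) ler_int.
  apply: le_trans (ler_norm_sum _ _ _) _; apply: ler_sum => k _.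
  rewrite normrM ler_piMr // mxE.
  by have /andP[h1 h2] := floor_itv (m%:R * M k j); rewrite intrD in h2; rewrite ler_norml; lra.
have X2 : nrm1 (intv x *m M) <= 2 * N%:R.
  have h1 := nrm1_le key.
  have h2 := HK (intv x *m M); rewrite mulmxK // in h2.
  have h3 : N%:R * (nrm1 (intv x) / m%:R) <= nrm1 (intv x *m M) / 2.
    rewrite mulrA ler_pdivrMr // -mulrA mulrC.
    have := nrm1_ge0 (intv x *m M); have := ler0n R N; nra.
  lra.
move=> j; apply: le_trans (key j) _.
rewrite -[leRHS]/(1 + 1) lerD2l ler_pdivrMr // mul1r; apply: le_trans mK.
have := HK (intv x *m M); rewrite mulmxK //.
by have := ler0n R N; nra.
Unshelve. all: by end_near. Qed.

End ShortVectors.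

(** * Short vectors orthogonal to given integer vectors *)

Section Pivoting.
Variable R : realType.

(* [T] completes [s] by unit vectors, chosen greedily so that the coordinates along them
   stay bounded. *)
Definition pivoted (N : nat) (s : seq 'rV[R]_N) (U : {set 'I_N}) (T : 'M[R]_N) :=
  [/\ T \in unitmx,
      (forall k, k \in U -> row k T = delta_mx 0 k) /\
      (forall k, k \notin U -> row k T \in s),
      forall v, v \in s -> exists2 k, k \notin U & row k T = v,
      (#|U| + size s = N)%N &
      forall (u : 'rV[R]_N) k, k \in U ->
        `|(u *m invmx T) 0 k| <= 2 ^+ size s * nrm1 u].

(** Steinitz exchange with pivoting: the new vector replaces the unit vector at which its coordinate
    is largest, so the ratios in the update are at most 1 and the coordinate bound at most
    doubles. *)
Lemma pivot_exists (N : nat) (s : seq 'rV[R]_N) : free s ->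
  exists U T, pivoted s U T.
Proof.
elim: s => [_|v s IH].
  exists [set: 'I_N], 1%:M; split.
  - exact: unitmx1.
  - by split=> k; rewrite ?inE // => _; rewrite row1.
  - by [].
  - by rewrite cardsT card_ord addn0.
  - by move=> u k _; rewrite invmx1 mulmx1 expr0 mul1r nrm1_coord.
rewrite free_cons => /andP[vs fs].
have [U [T [Tu [TU TnU] sT cU bT]]] := IH fs.
have [c cE] : exists c, c = v *m invmx T by exists (v *m invmx T).
have vE : v = \sum_k c 0 k *: row k T by rewrite -mulmx_sum_row cE mulmxKV.
have [k1 k1U ck1] : exists2 k, k \in U & c 0 k != 0.
  apply: contrapT => H; move/negP: vs; apply; rewrite vE.
  apply: memv_suml => k _; have [kU|kU] := boolP (k \in U).
    suff -> : c 0 k = 0 by rewrite scale0r mem0v.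
    by apply/eqP/negPn/negP => ck; apply: H; exists k.
  by apply: memvZ; apply: memv_span; exact: TnU.
case: (@Order.TotalTheory.arg_maxP _ _ _ k1 (mem U) (fun k => `|c 0 k|) k1U) => k0 k0U' kmax.
have k0U : k0 \in U := k0U'.
have ck0 : c 0 k0 != 0.
  by rewrite -normr_gt0; apply: lt_le_trans (kmax _ k1U); rewrite normr_gt0.
pose T' : 'M[R]_N := \matrix_i (if i == k0 then v else row i T).
(* Turns coordinates along the rows of [T] into coordinates along those of [T'], where row [k0] has
   become [v]. *)
pose upd (a : 'rV[R]_N) : 'rV[R]_N :=
  \row_j (if j == k0 then a 0 k0 / c 0 k0 else a 0 j - a 0 k0 / c 0 k0 * c 0 j).
have updE a : upd a *m T' = a *m T.
  rewrite !mulmx_sum_row (bigD1 k0) //= [RHS](bigD1 k0) //= !mxE eqxx rowK eqxx.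
  have vE' : v = c 0 k0 *: row k0 T + \sum_(j | j != k0) c 0 j *: row j T.
    by rewrite {1}vE (bigD1 k0).
  rewrite [X in _ *: X + _ = _]vE' scalerDr scalerA divfK //.
  rewrite -addrA; congr (_ + _); rewrite scaler_sumr -big_split /=.
  apply: eq_bigr => j jk0; rewrite !mxE (negPf jk0) rowK (negPf jk0).
  by rewrite scalerA -scalerDl; congr (_ *: _); ring.
pose B : 'M[R]_N := \matrix_i upd (row i (invmx T)).
have BT : B *m T' = 1%:M.
  apply/row_matrixP => i; rewrite row_mul rowK updE -row_mul mulVmx //.
have [_ T'u] := mulmx1_unit BT.
have invT' u : u *m invmx T' = upd (u *m invmx T).
  by rewrite -[LHS](mulmxK T'u); rewrite mulmxKV // -[u in LHS](mulmxKV Tu) -updE mulmxK.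
exists (U :\ k0), T'; split.
- exact: T'u.
- split=> k; rewrite !inE.
    by case/andP => kk0 kU; rewrite rowK (negPf kk0) TU.
  rewrite negb_and negbK rowK; case: ifP => _ /=; first by rewrite eqxx.
  by move=> kU; rewrite TnU ?orbT.
- move=> w; rewrite inE => /orP[/eqP ->|ws].
    by exists k0; rewrite ?inE ?eqxx // rowK eqxx.
  have [k kU kw] := sT _ ws; exists k; first by rewrite !inE (negPf kU) andbF.
  by rewrite rowK ifN //; apply: contraNneq kU => ->.
- by move: cU; rewrite (cardsD1 k0 U) k0U /=; lia.
- move=> u k; rewrite !inE => /andP[kk0 kU]; rewrite invT' mxE (negPf kk0).
  apply: le_trans (ler_normB _ _) _; rewrite normrM normf_div -mulrA.
  have b1 := bT u k kU; have b0 := bT u k0 k0U.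
  have h : `|(u *m invmx T) 0 k0| * (`|c 0 k0|^-1 * `|c 0 k|) <= `|(u *m invmx T) 0 k0|.
    rewrite ler_piMr // mulrC ler_pdivrMr ?normr_gt0 // mul1r; exact: kmax.
  by rewrite exprS -mulrA mulr_natl mulr2n; apply: lerD => //; exact: le_trans h b0.
Qed.

(** The expanded product of l1 norms has one nonnegative term for each self-map of the indices; the
    terms of the permutations alone dominate the Leibniz formula. *)
Lemma det_le_prod_nrm1 (N : nat) (T : 'M[R]_N) :
  `|\det T| <= \prod_k nrm1 (row k T).
Proof.
rewrite /nrm1 bigA_distr_bigA /= /determinant.
apply: le_trans (ler_norm_sum _ _ _) _.
pose h (s : 'S_N) : {ffun 'I_N -> 'I_N} := pval s.
rewrite [leRHS](bigID (fun f => f \in [set h s | s : 'S_N])) /=.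
rewrite -[leLHS]addr0; apply: lerD; last first.
  by apply: sumr_ge0 => f _; apply: prodr_ge0.
rewrite big_imset /=; last by move=> s1 s2 _ _ /val_inj.
apply: ler_sum => s _; rewrite normrM normrX normrN1 expr1n mul1r normr_prod.
by rewrite le_eqVlt; apply/orP; left; apply/eqP; apply: eq_bigr => i _; rewrite mxE pvalE.
Qed.

Lemma unitmx_row_inj (N : nat) (T : 'M[R]_N) k k' : T \in unitmx ->
  row k T = row k' T -> k = k'.
Proof.
move=> Tu kk'; apply/eqP/negPn/negP => nkk'.
have : \det T == 0.
  by apply/eqP/(determinant_alternate nkk') => j; have /rowP/(_ j) := kk'; rewrite !mxE.
by move: Tu; rewrite unitmxE unitfE => /negPf ->.
Qed.

Lemma pivoted_det_le (N : nat) (s : seq 'rV[R]_N) U T : uniq s -> pivoted s U T ->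
  `|\det T| <= \prod_(v <- s) nrm1 v.
Proof.
move=> us [Tu [TU TnU] sT cU _]; apply: le_trans (det_le_prod_nrm1 T) _.
rewrite (bigID (mem U)) /= big1 ?mul1r => [|k kU]; last by rewrite TU // nrm1_delta.
have rinj : {in [predC U] &, injective (fun k => row k T)}.
  by move=> k k' _ _; exact: unitmx_row_inj.
rewrite le_eqVlt; apply/orP; left; apply/eqP.
rewrite -big_filter -(big_map (fun k => row k T) xpredT (@nrm1 R N)).
apply: perm_big; apply: uniq_perm => //.
  rewrite map_inj_in_uniq ?filter_uniq ?index_enum_uniq // => k k'.
  by rewrite !mem_filter => /andP[? _] /andP[? _]; apply: rinj.
move=> v; apply/mapP/idP => [[k]|vs].
  by rewrite mem_filter => /andP[kU _] ->; exact: TnU.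
have [k kU <-] := sT _ vs; exists k => //.
by rewrite mem_filter kU mem_index_enum.
Qed.

Definition dotv (N : nat) (u v : 'rV[R]_N) : R := (u *m v^T) 0 0.

Lemma intv_dot (N : nat) (x y : 'rV[int]_N) : dotv (intv R x) (intv R y) = ((x *m y^T) 0 0)%:~R.
Proof.
rewrite /dotv !mxE rmorph_sum /=; apply: eq_bigr => j _.
by rewrite !mxE intrM.
Qed.

Lemma dot_dual (N : nat) (G H : 'M[R]_N) (u v : 'rV[R]_N) : G *m H^T = 1%:M ->
  dotv (u *m G) (v *m H) = dotv u v.
Proof. by move=> GH; rewrite /dotv trmx_mul mulmxA -(mulmxA u) GH mulmx1. Qed.

Lemma dot_le (N : nat) (u v : 'rV[R]_N) : `|dotv u v| <= nrm1 u * nrm1 v.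
Proof.
rewrite /dotv mxE; apply: le_trans (ler_norm_sum _ _ _) _.
rewrite /nrm1 mulr_suml; apply: ler_sum => j _; rewrite mxE normrM.
by rewrite ler_wpM2l //; exact: nrm1_coord.
Qed.

Lemma prod_if_set (N d : nat) (U : {set 'I_N}) (a b : R) : (#|U| + d = N)%N ->
  \prod_k (if k \in U then a else b) = b ^+ d * a ^+ #|U|.
Proof.
move=> cU; rewrite (bigID (mem U)) /= mulrC; congr (_ * _).
  rewrite (eq_bigr (fun=> b)) => [|k kU]; last by rewrite (negPf kU).
  rewrite prodr_const; congr (_ ^+ _).
  have := cardC (mem U); rewrite card_ord => e.
  apply/eqP; rewrite -(eqn_add2l #|U|); apply/eqP.
  by apply: etrans (esym cU); apply: etrans e; congr (_ + _)%N; apply: eq_card => k; rewrite !inE.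
rewrite (eq_bigr (fun=> a)) => [|k kU]; last by rewrite kU.
by rewrite prodr_const.
Qed.

(** Minkowski for the forms [y |-> <y H, row k T>]. On the rows coming from [X] these are the
    integers [<y, x>], by duality, so a bound below 1 makes [y] orthogonal to [X]; on the unit rows
    they are at most [2 rho]. The bounded coordinates along the unit rows then control all of
    [y H]. *)
Lemma short_dual (N : nat) (G H : 'M[R]_N) (X : seq 'rV[int]_N) U T rho :
  G *m H^T = 1%:M -> `|\det H| = 1 ->
  pivoted [seq intv R x *m G | x <- X] U T ->
  0 < rho -> 4 ^+ size X * `|\det T| < rho ^+ #|U| ->
  exists2 y : 'rV[int]_N, y != 0 &
    nrm1 (intv R y *m H) <= N%:R * (N%:R * (2 ^+ size X * (2 * rho))).
Proof.
move=> GH dH [Tu [TU TnU] _ cU bT] r0 dT.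
rewrite size_map in cU bT.
(* With weight 4 the bound 2 leaves at most 1/2 for the integers [<y, x>], which therefore
   vanish. *)
pose dl (k : 'I_N) : R := if k \in U then rho^-1 else 4.
have dl0 k : 0 < dl k by rewrite /dl; case: ifP => _; rewrite ?invr_gt0.
have dlE : \prod_k dl k = 4 ^+ size X / rho ^+ #|U|.
  by rewrite (prod_if_set _ _ cU) exprVn.
have Hu : H \in unitmx.
  by rewrite unitmxE unitfE -normr_eq0 dH oner_eq0.
have [||y y0 yM] := @linear_forms_short R N (H *m T^T *m diag_mx (\row_k dl k)).
- rewrite !unitmx_mul Hu unitmx_tr Tu /= unitmxE det_diag unitfE.
  by apply/prodf_neq0 => k _; rewrite mxE gt_eqF.
- rewrite !det_mulmx det_tr det_diag !normrM dH mul1r.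
  under eq_bigr do rewrite mxE.
  have d0 : 0 <= 4 ^+ size X / rho ^+ #|U| :> R.
    by rewrite divr_ge0 ?exprn_ge0 ?ltW.
  rewrite dlE (ger0_norm d0) mulrA ltr_pdivrMr ?exprn_gt0 //.
  by rewrite mul1r mulrC.
exists y => //.
have comp k : (intv R y *m (H *m T^T *m diag_mx (\row_k dl k))) 0 k
     = dotv (intv R y *m H) (row k T) * dl k.
  rewrite !mulmxA mul_mx_diag [LHS]mxE [X in _ * X]mxE; congr (_ * _).
  by rewrite /dotv !mxE; apply: eq_bigr => j _; rewrite !mxE.
have znU k : k \notin U -> dotv (intv R y *m H) (row k T) = 0.
  move=> kU; have := yM k; rewrite comp /dl (negPf kU) normrM.
  have /mapP[x _ ->] := TnU k kU.
  have HG : H *m G^T = 1%:M by rewrite -[H]trmxK -trmx_mul GH trmx1.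
  rewrite dot_dual // intv_dot -intr_norm.
  case: (eqVneq ((y *m x^T) 0 0) 0) => [-> //|nz] h; exfalso.
  have : (1 : R) <= `|(y *m x^T) 0 0|%:~R by rewrite ler1z -gtz0_ge1 normr_gt0.
  by move: h; rewrite ger0_norm; lra.
have bU k : k \in U -> `|dotv (intv R y *m H) (row k T)| <= 2 * rho.
  move=> kU; have := yM k; rewrite comp /dl kU normrM normfV (gtr0_norm r0).
  by rewrite ler_pdivrMr.
apply: nrm1_le => j.
have -> : (intv R y *m H) 0 j = dotv (intv R y *m H) (delta_mx 0 j).
  by rewrite /dotv trmx_delta -colE [RHS]mxE.
pose ej : 'rV[R]_N := delta_mx 0 j.
have -> : dotv (intv R y *m H) ej = \sum_k (ej *m invmx T) 0 k * dotv (intv R y *m H) (row k T).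
  rewrite -{1}(mulmxKV Tu ej) [ej *m _ *m T]mulmx_sum_row /dotv linear_sum mulmx_sumr summxE.
  by apply: eq_bigr => k _; rewrite linearZ /= -scalemxAr mxE.
apply: le_trans (ler_norm_sum _ _ _) _.
rewrite mulr_natl -[X in _ <= _ *+ X](card_ord N) -sumr_const.
apply: ler_sum => k _; rewrite normrM; have [kU|kU] := boolP (k \in U).
  apply: ler_pM => //; last exact: bU.
  by have := bT ej k kU; rewrite nrm1_delta mulr1.
by rewrite znU // normr0 mulr0 mulr_ge0 ?exprn_ge0 // mulr_ge0 // ltW.
Qed.

End Pivoting.

(** * Transference between the last minimum and the dual lattice *)

Section Transference.
Variable R : realType.

Lemma lattice_discrete (N : nat) (G : 'M[R]_N) : G \in unitmx ->
  exists2 c, 0 < c & forall x : 'rV[int]_N, x != 0 -> c <= nrm1 (intv R x *m G).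
Proof.
move=> Gu; have [K K0 HK] := nrm1_mul_bounded (invmx G).
exists K^-1; first by rewrite invr_gt0.
move=> x x0; rewrite -[leLHS]mul1r ler_pdivrMr // mulrC.
apply: le_trans (HK _); rewrite mulmxK //.
have [j xj] : exists j, x 0 j != 0.
  apply: contrapT => H; move/eqP: x0; apply; apply/rowP => j; rewrite mxE.
  by apply/eqP/negPn/negP => xj; apply: H; exists j.
apply: le_trans (nrm1_coord _ j); rewrite mxE -intr_norm ler1z.
by rewrite -gtz0_ge1 normr_gt0.
Qed.

(** Stands for vectors realising the successive minima up to [A], the last chosen at the head; the
    factor 2 leaves room for an infimum that is only nearly reached. *)
Fixpoint near_minimal (N : nat) (G : 'M[R]_N) (A : R) (X : seq 'rV[int]_N) : Prop :=
  if X is x :: X' then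
    [/\ intv R x *m G \notin <<[seq intv R y *m G | y <- X']>>%VS,
        nrm1 (intv R x *m G) <= A,
        forall z, intv R z *m G \notin <<[seq intv R y *m G | y <- X']>>%VS ->
          nrm1 (intv R x *m G) <= 2 * nrm1 (intv R z *m G) &
        near_minimal G A X']
  else True.

Lemma near_minimal_free (N : nat) (G : 'M[R]_N) A X :
  near_minimal G A X -> free [seq intv R y *m G | y <- X].
Proof.
elim: X => [_|x X IH]; first by rewrite nil_free.
by move=> /= [xX _ _ /IH fX]; rewrite free_cons xX.
Qed.

Lemma near_minimal_bound (N : nat) (G : 'M[R]_N) A X :
  near_minimal G A X -> forall x, x \in X -> nrm1 (intv R x *m G) <= A.
Proof.
elim: X => [//|x X IH] /= [_ xA _ /IH XA] y.
by rewrite inE => /orP[/eqP ->|/XA].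
Qed.

Lemma near_minimal_le (N : nat) (G : 'M[R]_N) A X z :
  near_minimal G A X -> intv R z *m G \notin <<[seq intv R y *m G | y <- X]>>%VS ->
  forall y, y \in X -> nrm1 (intv R y *m G) <= 2 * nrm1 (intv R z *m G).
Proof.
elim: X => [//|x X IH] /= [_ _ xmin /IH Xmin] zX.
have zX' : intv R z *m G \notin <<[seq intv R y *m G | y <- X]>>%VS.
  apply: contra zX => /(subvP _) h; rewrite span_cons.
  by apply: (subvP (addvSr _ _)); exact: h.
move=> y; rewrite inE => /orP[/eqP ->|]; first exact: xmin.
exact: Xmin.
Qed.

Lemma free_size_le (N : nat) (s : seq 'rV[R]_N) : free s -> (size s <= N)%N.
Proof.
move=> /eqP <-; apply: leq_trans (dimvS (subvf _)) _.
by rewrite dimvf dim_matrix; lia.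
Qed.

(** A list whose span misses some point of norm at most [A] can be extended, and freeness caps the
    length at [N]. *)
Lemma near_minimal_exists (N : nat) (G : 'M[R]_N) A : G \in unitmx ->
  exists X, near_minimal G A X /\ forall z, nrm1 (intv R z *m G) <= A ->
    intv R z *m G \in <<[seq intv R y *m G | y <- X]>>%VS.
Proof.
move=> Gu; have [c c0 Hc] := lattice_discrete Gu.
apply: contrapT => H.
suff /(_ N.+1) [X [XG sX]] : forall m, exists X, near_minimal G A X /\ size X = m.
  by have := free_size_le (near_minimal_free XG); rewrite size_map sX ltnn.
elim=> [|m [X [XG sX]]]; first by exists [::].
pose S : set R := [set r : R | exists2 z : 'rV[int]_N,
  intv R z *m G \notin <<[seq intv R y *m G | y <- X]>>%VS & r = nrm1 (intv R z *m G)]%classic.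
have Sc r : S r -> c <= r.
  move=> [z zX ->]; apply: Hc; apply: contraNneq zX => ->.
  by rewrite intv0 mul0mx mem0v.
have [z0 z0A z0X] : exists2 z, nrm1 (intv R z *m G) <= A &
    intv R z *m G \notin <<[seq intv R y *m G | y <- X]>>%VS.
  apply: contrapT => H'; apply: H; exists X; split=> // z zA.
  by apply/negPn/negP => zX; apply: H'; exists z.
have S0 : (S !=set0)%classic by exists (nrm1 (intv R z0 *m G)); exists z0.
have Slb : has_lbound S by exists c.
have infc : c <= inf S by apply: lb_le_inf.
have [r [z zX rE] rlt] : exists2 r, S r & r < 2 * inf S.
  have i0 : 0 < inf S by lra.
  have [r Sr rS] := inf_adherent i0 (conj S0 Slb).
  by exists r => //; lra.
have zmin z' : intv R z' *m G \notin <<[seq intv R y *m G | y <- X]>>%VS ->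
    nrm1 (intv R z *m G) <= 2 * nrm1 (intv R z' *m G).
  move=> z'X; have : inf S <= nrm1 (intv R z' *m G) by apply: ge_inf => //; exists z'.
  by rewrite rE in rlt; lra.
have [zA|zA] := leP (nrm1 (intv R z *m G)) A.
  by exists (z :: X); split; rewrite /= ?sX.
(* The near minimiser is longer than [A], so [z0], of norm at most [A], is itself within the factor
   2 of every competitor. *)
exists (z0 :: X); split; rewrite /= ?sX //; split=> // z' z'X.
by apply: le_trans (zmin _ z'X); apply: le_trans z0A (ltW zA).
Qed.

(** Take the first vector of the list with a nonzero coordinate. As [z] is outside the span of those
    behind it, that vector is at most twice as long as [z], while the small coordinates make [z] at
    most a quarter as long as that vector. *)
Lemma near_minimal_small_coords (N : nat) (G T : 'M[R]_N) A X (z : 'rV[int]_N) (a : 'rV[R]_N) :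
  T \in unitmx -> near_minimal G A X -> intv R z *m G = a *m T ->
  (forall k, `|a 0 k| <= (8 * N%:R)^-1) ->
  (forall k, a 0 k != 0 -> row k T \in [seq intv R y *m G | y <- X]) ->
  a = 0.
Proof.
move=> Tu XG zE asmall.
elim: X XG => [_ H|x X IH /= [xX xA xmin XG] H].
  apply/rowP => k; rewrite mxE; apply/eqP/negPn/negP => /H.
  by rewrite in_nil.
apply: (IH XG) => k ak.
have [//|kX] := boolP (row k T \in _); exfalso.
have kx : row k T = intv R x *m G.
  by move: (H k ak); rewrite inE (negPf kX) orbF => /eqP.
have oth k' : k' != k -> a 0 k' != 0 -> row k' T \in [seq intv R y *m G | y <- X].
  move=> k'k ak'; move: (H k' ak'); rewrite inE => /orP[/eqP e|//].
  by move: k'k; rewrite (@unitmx_row_inj _ _ T k' k) ?eqxx // e kx.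
have aT : a *m T = a 0 k *: row k T + \sum_(i | i != k) a 0 i *: row i T.
  by rewrite mulmx_sum_row (bigD1 k).
have [zX|zX] := boolP (intv R z *m G \in <<[seq intv R y *m G | y <- X]>>%VS).
  move/negP: xX; apply; rewrite -kx -(scalerK ak (row k T)); apply: memvZ.
  have -> : a 0 k *: row k T = intv R z *m G - \sum_(i | i != k) a 0 i *: row i T.
    by rewrite zE aT addrK.
  apply: memvB => //; apply: memv_suml => i ik.
  have [->|ai] := eqVneq (a 0 i) 0; first by rewrite scale0r mem0v.
  by apply: memvZ; apply: memv_span; exact: oth.
have N0 : 0 < N%:R :> R by rewrite ltr0n (leq_trans _ (ltn_ord k)).
have h1 : nrm1 (intv R z *m G) <= N%:R * ((8 * N%:R)^-1 * (2 * nrm1 (intv R x *m G))).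
  rewrite zE mulmx_sum_row; apply: le_trans (nrm1_sum _ _ _) _.
  rewrite mulr_natl -[X in _ <= _ *+ X](card_ord N) -sumr_const; apply: ler_sum => i _.
  rewrite nrm1Z; have [->|ai] := eqVneq (a 0 i) 0.
    by rewrite normr0 mul0r !mulr_ge0 ?invr_ge0 ?mulr_ge0 ?nrm1_ge0 ?ler0n.
  apply: ler_pM; rewrite ?nrm1_ge0 //.
  move: (H i ai); rewrite inE => /orP[/eqP ->|/mapP[y yX ->]].
    by have := nrm1_ge0 (intv R x *m G); lra.
  exact: (near_minimal_le XG xX).
have h2 := xmin _ zX.
have h3 : N%:R * ((8 * N%:R)^-1 * (2 * nrm1 (intv R x *m G))) = nrm1 (intv R x *m G) / 4.
  by field; rewrite gt_eqF.
have : nrm1 (intv R x *m G) == 0.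
  by rewrite eq_le nrm1_ge0 andbT; have := nrm1_ge0 (intv R x *m G); lra.
by rewrite nrm1_eq0 => /eqP x0; move: xX; rewrite x0 mem0v.
Qed.

Lemma pivoted_coord0 (N : nat) (s : seq 'rV[R]_N) U T v k :
  pivoted s U T -> v \in << s >>%VS -> k \in U -> (v *m invmx T) 0 k = 0.
Proof.
move=> [Tu _ sT _ _] vs kU.
have : forall s', {subset s' <= s} -> v \in << s' >>%VS -> (v *m invmx T) 0 k = 0.
  move=> s'; elim: s' v {vs} => [v _|w s' IH v ss'].
    by rewrite span_nil memv0 => /eqP ->; rewrite mul0mx mxE.
  rewrite span_cons => /memv_addP[v1 /vlineP[b ->] [v2 v2s ->]].
  rewrite mulmxDl mxE (IH _ _ v2s); last first.
    by move=> u us'; apply: ss'; rewrite inE us' orbT.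
  have [k' k'U <-] := sT w (ss' _ (mem_head _ _)).
  rewrite -scalemxAl rowE -mulmxA mulmxV // mulmx1 !mxE.
  by rewrite eqxx /= addr0; case: eqVneq kU => [->|_ _]; rewrite ?(negPf k'U) ?mulr0.
by move=> /(_ s (fun _ h => h) vs).
Qed.

(* If [det T] were larger, the linear forms theorem would give a lattice point in the span of
   [X] with coefficients so small that it is less than half as long as the first vector of
   [X] it involves. *)
Lemma near_minimal_det (N : nat) (G : 'M[R]_N) A X U T :
  G \in unitmx -> `|\det G| = 1 -> 0 < A -> (0 < N)%N -> near_minimal G A X ->
  (forall z, nrm1 (intv R z *m G) <= A ->
    intv R z *m G \in <<[seq intv R y *m G | y <- X]>>%VS) ->
  pivoted [seq intv R y *m G | y <- X] U T ->
  `|\det T| <= (16 * N%:R) ^+ size X * (4 * N%:R / A) ^+ #|U|.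
Proof.
move=> Gu dG A0 N0 XG Xmax pv; have [Tu [TU TnU] sT cU bT] := pv.
have N0' : 0 < N%:R :> R by rewrite ltr0n.
rewrite leNgt; apply/negP => Tbig.
(* The weights turn the bound 2 into [A / (2 N)] on unit rows and [1 / (8 N)] on lattice rows.
   Together these keep [z] of norm at most [A], hence in the span of [X]; the second is also the
   threshold of [near_minimal_small_coords]. *)
pose dl (k : 'I_N) : R := if k \in U then 4 * N%:R / A else 16 * N%:R.
have dl0 k : 0 < dl k.
  by rewrite /dl; case: ifP => _; rewrite ?divr_gt0 ?mulr_gt0.
rewrite size_map in cU.
have dlE : \prod_k dl k = (16 * N%:R) ^+ size X * (4 * N%:R / A) ^+ #|U|.
  exact: prod_if_set.
have dT0 : 0 < `|\det T| by rewrite normr_gt0 -unitfE -unitmxE.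
have [||z z0 zM] := @linear_forms_short R N (G *m invmx T *m diag_mx (\row_k dl k)).
- rewrite !unitmx_mul Gu unitmx_inv Tu /= unitmxE det_diag unitfE.
  by apply/prodf_neq0 => k _; rewrite mxE gt_eqF.
- rewrite !det_mulmx det_inv det_diag !normrM dG mul1r normfV.
  under eq_bigr do rewrite mxE.
  rewrite (@ger0_norm _ (\prod_i _)); last by apply: prodr_ge0 => k _; rewrite ltW.
  by rewrite mulrC ltr_pdivrMr // mul1r dlE.
pose a := intv R z *m G *m invmx T.
have ac k : `|a 0 k| * dl k <= 2.
  have := zM k; rewrite !mulmxA mul_mx_diag mxE [X in _ * X]mxE normrM.
  by rewrite (gtr0_norm (dl0 k)).
have zE : intv R z *m G = a *m T by rewrite mulmxKV.
have aU k : k \in U -> `|a 0 k| <= A / (2 * N%:R).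
  move=> kU; rewrite ler_pdivlMr ?mulr_gt0 //; have := ac k; rewrite /dl kU.
  rewrite mulrA ler_pdivrMr // mulrA; lra.
have anU k : k \notin U -> `|a 0 k| <= (8 * N%:R)^-1.
  move=> kU; rewrite -[leRHS]mul1r ler_pdivlMr ?mulr_gt0 //.
  by have := ac k; rewrite /dl (negPf kU); lra.
have zA : nrm1 (intv R z *m G) <= A.
  have -> : A = N%:R * (A / N%:R) by field; rewrite gt_eqF.
  rewrite zE mulmx_sum_row; apply: le_trans (nrm1_sum _ _ _) _.
  rewrite mulr_natl -[X in _ <= _ *+ X](card_ord N) -sumr_const; apply: ler_sum => k _.
  rewrite nrm1Z; have [kU|kU] := boolP (k \in U).
    rewrite TU // nrm1_delta mulr1; apply: le_trans (aU k kU) _.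
    rewrite ler_pM2l // lef_pV2 ?posrE ?mulr_gt0 //; lra.
  have /mapP[x xX ->] := TnU k kU.
  have xA := near_minimal_bound XG xX.
  rewrite mulrC; apply: ler_pM; rewrite ?nrm1_ge0 //.
  apply: le_trans (anU k kU) _.
  rewrite lef_pV2 ?posrE ?mulr_gt0 //; lra.
have az k : k \in U -> a 0 k = 0 by apply: (pivoted_coord0 pv); exact: Xmax.
have a0 : a = 0.
  apply: (near_minimal_small_coords Tu XG zE).
    move=> k; have [kU|] := boolP (k \in U); last exact: anU.
    by rewrite az // normr0 invr_ge0 mulr_ge0.
  move=> k ak; apply: TnU; apply: contra_neqN ak; exact: az.
move/eqP: z0; apply; apply/eqP; rewrite -(intv_eq0 R).
by rewrite -(mulmxK Gu (intv R z)) zE a0 !mul0mx.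
Qed.

(** If no [N] independent points have norm at most [A], at least one unit row is left in [T], and
    each unit row brings a factor [1 / A] into the bound for [det T]; [short_dual] turns this into a
    dual vector of size [O(1 / A)]. *)
Lemma transference (N : nat) : (0 < N)%N ->
  exists2 C : R, 0 < C & forall (G H : 'M[R]_N) A,
    G *m H^T = 1%:M -> `|\det G| = 1 -> `|\det H| = 1 -> 0 < A ->
    (forall X, size X = N -> free [seq intv R x *m G | x <- X] ->
       exists2 x, x \in X & A < nrm1 (intv R x *m G)) ->
    exists2 y : 'rV[int]_N, y != 0 & nrm1 (intv R y *m H) <= C / A.
Proof.
move=> N0; have N0' : 1 <= N%:R :> R by rewrite ler1n.
(* [64 N] is the 4 of [short_dual] times the 16 [N] of [near_minimal_det], [4 N] is the numerator on
   unit rows, and 2 makes the inequality strict. One power of the first two factors is enough since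
   [#|U| >= 1]. *)
pose C0 : R := 2 * (64 * N%:R) ^+ N * (4 * N%:R).
have C00 : 0 < C0 by rewrite !mulr_gt0 ?exprn_gt0 ?mulr_gt0 //; lra.
exists (N%:R * (N%:R * (2 ^+ N * (2 * C0)))).
  by rewrite !mulr_gt0 ?exprn_gt0 //; lra.
move=> G H A GH dG dH A0 noX.
have Gu : G \in unitmx by rewrite unitmxE unitfE -normr_eq0 dG oner_eq0.
have [X [XG Xmax]] := near_minimal_exists A Gu.
have fX := near_minimal_free XG.
have sX : (size X < N)%N.
  have := free_size_le fX; rewrite size_map leq_eqVlt => /orP[/eqP sX|//].
  have [x xX] := noX X sX fX; rewrite ltNge => /negP []; exact: (near_minimal_bound XG).
have [U [T pv]] := pivot_exists fX.
have dT := near_minimal_det Gu dG A0 N0 XG Xmax pv.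
have cU : (#|U| + size X = N)%N by case: pv => _ _ _; rewrite size_map.
have U0 : (0 < #|U|)%N by lia.
have r0 : 0 < C0 / A by rewrite divr_gt0.
have lt : 4 ^+ size X * `|\det T| < (C0 / A) ^+ #|U|.
  apply: le_lt_trans (ler_wpM2l _ dT) _; first by rewrite exprn_ge0.
  rewrite mulrA -exprMn !expr_div_n mulrA ltr_pM2r ?invr_gt0 ?exprn_gt0 //.
  rewrite /C0 [ltRHS]exprMn ltr_pM2r ?exprn_gt0 //; last lra.
  have -> : 4 * (16 * N%:R) = 64 * N%:R :> R by ring.
  have g1 : 1 <= 64 * N%:R :> R by lra.
  apply: le_lt_trans (ler_weXn2l g1 (ltnW sX)) _.
  have p0 : 1 <= (64 * N%:R) ^+ N :> R by rewrite exprn_ege1.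
  apply: (@lt_le_trans _ _ ((2 * (64 * N%:R) ^+ N) ^+ 1)); first by rewrite expr1; lra.
  by apply: ler_weXn2l => //; lra.
have [y y0 yH] := short_dual GH dH pv r0 lt.
exists y => //; apply: le_trans yH _.
have -> : N%:R * (N%:R * (2 ^+ N * (2 * C0))) / A = N%:R * (N%:R * (2 ^+ N * (2 * (C0 / A)))).
  by rewrite !mulrA.
do 2 (apply: ler_wpM2l; first by lra).
apply: ler_wpM2r; first by apply: mulr_ge0 => //; exact: ltW.
by apply: ler_weXn2l; [lra | exact: ltnW].
Qed.

(* The combination [w] of [u] and [v] that vanishes at the coordinate [i0] satisfies
   [y /\ w = - y 0 i0 * (u /\ v)]. *)
Lemma pivoted_pair_det (N : nat) (u v y : 'rV[R]_N) al be i0 U T :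
  u != v -> pivoted [:: u; v] U T -> y = al *: u + be *: v ->
  `|\det T| * `|y 0 i0| <= nrm1 y * nrm1 (v 0 i0 *: u - u 0 i0 *: v).
Proof.
move=> uv [Tu [TU TnU] sT cU _] yE.
have [k1 k1U k1u] := sT u (mem_head _ _).
have [k2 k2U k2v] : exists2 k, k \notin U & row k T = v.
  by apply: sT; rewrite !inE eqxx orbT.
have k12 : k1 != k2 by apply: contraNneq uv => e; rewrite -k1u e k2v.
(* [det T] as an alternating bilinear form in the two rows that hold [u] and [v]. *)
pose D (a b : 'rV[R]_N) := \det (\matrix_k (if k == k1 then a else if k == k2 then b else row k T)).
have DT : D u v = \det T.
  congr (\det _); apply/row_matrixP => k; rewrite rowK.
  by case: eqVneq => [->//|_]; case: eqVneq => [->|].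
have Dl a b c d w : D (c *: a + d *: b) w = c * D a w + d * D b w.
  apply: (@determinant_multilinear _ _ _ _ _ k1).
  - by rewrite !rowK eqxx.
  - by apply/matrixP => i j; rewrite !mxE [_ == k1]eq_sym (negPf (neq_lift _ _)).
  - by apply/matrixP => i j; rewrite !mxE [_ == k1]eq_sym (negPf (neq_lift _ _)).
have Dr a b c d w : D w (c *: a + d *: b) = c * D w a + d * D w b.
  have k21 : (k2 == k1) = false by rewrite eq_sym (negPf k12).
  apply: (@determinant_multilinear _ _ _ _ _ k2).
  - by rewrite !rowK k21 eqxx.
  - by apply/matrixP => i j; rewrite !mxE [_ == k2]eq_sym (negPf (neq_lift _ _)).
  - by apply/matrixP => i j; rewrite !mxE [_ == k2]eq_sym (negPf (neq_lift _ _)).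
have Daa a : D a a = 0.
  apply: (determinant_alternate k12) => j; rewrite !mxE eqxx.
  by rewrite eq_sym (negPf k12) eqxx.
have Dle a b : `|D a b| <= nrm1 a * nrm1 b.
  apply: le_trans (det_le_prod_nrm1 _) _.
  rewrite (bigD1 k1) //= (bigD1 k2) ?[k2 == _]eq_sym ?(negPf k12) //= !rowK eqxx.
  rewrite [k2 == _]eq_sym (negPf k12) eqxx mulrA big1 ?mulr1 // => k /andP[kk1 kk2].
  rewrite rowK (negPf kk1) (negPf kk2) TU ?nrm1_delta //.
  apply/negPn/negP => kU; have := TnU k kU; rewrite !inE -k1u -k2v.
  by case/orP => /eqP /(unitmx_row_inj Tu) e; rewrite e eqxx in kk1 kk2.
have Duu : D v u = - D u v.
  have := Daa (1 *: u + 1 *: v); rewrite Dl !Dr !Daa !mul1r; lra.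
have key : D y (v 0 i0 *: u - u 0 i0 *: v) = - y 0 i0 * \det T.
  rewrite -scaleNr {1}yE Dl !Dr !Daa Duu DT yE !mxE; ring.
by apply: le_trans (Dle _ _); rewrite key normrM normrN mulrC.
Qed.

End Transference.

(** * The flow on the lattice and its dual *)

Section Lattice.
Variable R : realType.

Lemma span_mulmx (N M : nat) (A : 'M[R]_(N, M)) (s : seq 'rV[R]_N) v :
  v \in << s >>%VS -> v *m A \in <<[seq u *m A | u <- s]>>%VS.
Proof.
elim: s v => [v|w s IH v]; first by rewrite span_nil memv0 => /eqP ->; rewrite mul0mx mem0v.
rewrite span_cons => /memv_addP[v1 /vlineP[b ->] [v2 v2s ->]].
rewrite mulmxDl -scalemxAl /= span_cons; apply: memv_add; last exact: IH.
by apply: memvZ; exact: memv_line.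
Qed.

Lemma free_mulmx (N : nat) (A : 'M[R]_N) (s : seq 'rV[R]_N) : A \in unitmx ->
  free s -> free [seq u *m A | u <- s].
Proof.
move=> Au; elim: s => [|v s IH]; first by rewrite !nil_free.
rewrite /= !free_cons => /andP[vs /IH ->]; rewrite andbT.
apply: contra vs => /(@span_mulmx _ _ (invmx A)); rewrite mulmxK //.
by rewrite -map_comp (@eq_map _ _ _ id) ?map_id // => u /=; rewrite mulmxK.
Qed.

(** Contrapositive of [short_dual] with the two lattices exchanged: a smaller [det T] would give a
    lattice point shorter than [lam]. Three vectors cost [2^3 = 8] and [4^3 = 64], and [32 N^2]
    brings the resulting length down to [lam / 2]. *)
Lemma pivoted_det_ge (N : nat) (G H : 'M[R]_N) (ys : seq 'rV[int]_N) U T lam :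
  G *m H^T = 1%:M -> `|\det G| = 1 -> (0 < N)%N -> (size ys <= 3)%N -> 0 < lam ->
  (forall x : 'rV[int]_N, x != 0 -> lam <= nrm1 (intv R x *m G)) ->
  pivoted [seq intv R y *m H | y <- ys] U T ->
  lam ^+ #|U| <= 64 * (32 * N%:R ^+ 2) ^+ N * `|\det T|.
Proof.
move=> GH dG N0 sy lam0 hlam pv.
have N1 : 1 <= N%:R :> R by rewrite ler1n.
have HG : H *m G^T = 1%:M by rewrite -[H]trmxK -trmx_mul GH trmx1.
pose k : R := 32 * N%:R ^+ 2.
have N2 : 1 <= N%:R ^+ 2 :> R by rewrite exprn_ege1.
have k1 : 1 <= k by rewrite /k; lra.
have r0 : 0 < lam / k by rewrite divr_gt0 //; lra.
have p2 : 2 ^+ size ys <= 8 :> R.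
  by rewrite (_ : 8 = 2 ^+ 3) ?ler_weXn2l //; [lra | rewrite !exprS expr0; lra].
have p4 : 4 ^+ size ys <= 64 :> R.
  by rewrite (_ : 64 = 4 ^+ 3) ?ler_weXn2l //; [lra | rewrite !exprS expr0; lra].
have h : (lam / k) ^+ #|U| <= 4 ^+ size ys * `|\det T|.
  rewrite leNgt; apply/negP => lt.
  have [x x0 xG] := short_dual HG dG pv r0 lt.
  have := le_trans (hlam x x0) xG; apply/negP; rewrite -ltNge.
  apply: (@le_lt_trans _ _ (N%:R * (N%:R * (8 * (2 * (lam / k)))))).
    do 2 (apply: ler_wpM2l; first lra).
    by apply: ler_wpM2r => //; apply: mulr_ge0 => //; exact: ltW.
  have -> : N%:R * (N%:R * (8 * (2 * (lam / k)))) = lam / 2.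
    by rewrite /k; field; rewrite gt_eqF //; lra.
  lra.
have kU : k ^+ #|U| <= k ^+ N.
  by apply: ler_weXn2l => //; have := max_card (mem U); rewrite card_ord.
have -> : lam ^+ #|U| = k ^+ #|U| * (lam / k) ^+ #|U|.
  by rewrite -exprMn mulrC divfK // gt_eqF //; lra.
apply: (@le_trans _ _ (k ^+ N * (64 * `|\det T|))); last by rewrite mulrCA mulrA.
apply: ler_pM; rewrite ?exprn_ge0 ?(ltW r0) //; first lra.
by apply: le_trans h _; rewrite ler_wpM2r.
Qed.

Lemma prod_lower (N : nat) (G H : 'M[R]_N) (ys : seq 'rV[int]_N) lam :
  G *m H^T = 1%:M -> `|\det G| = 1 -> (0 < N)%N -> (size ys <= 3)%N -> 0 < lam ->
  (forall x : 'rV[int]_N, x != 0 -> lam <= nrm1 (intv R x *m G)) ->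
  free [seq intv R y | y <- ys] ->
  lam ^+ (N - size ys) <= 64 * (32 * N%:R ^+ 2) ^+ N * \prod_(y <- ys) nrm1 (intv R y *m H).
Proof.
move=> GH dG N0 sy lam0 hlam fy.
have [_ Htu] := mulmx1_unit GH; have Hu : H \in unitmx by rewrite -unitmx_tr.
have fyH : free [seq intv R y *m H | y <- ys].
  by have := free_mulmx Hu fy; rewrite -map_comp.
have [U [T pv]] := pivot_exists fyH.
have := pivoted_det_ge GH dG N0 sy lam0 hlam pv.
have cU : (#|U| + size ys = N)%N by case: pv => _ _ _; rewrite size_map.
have -> : (N - size ys)%N = #|U| by lia.
move=> /le_trans; apply; apply: ler_wpM2l.
  by rewrite mulr_ge0 // exprn_ge0 // mulr_ge0 // exprn_ge0.
by have := pivoted_det_le (free_uniq fyH) pv; rewrite big_map.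
Qed.

(** Serves pairs whose wedge is far smaller than the product of their norms: [det T] is bounded
    through a known vector [y] of their plane. *)
Lemma pair_lower (N : nat) (G H : 'M[R]_N) (u v : 'rV[int]_N) (y : 'rV[R]_N) al be i0 lam :
  G *m H^T = 1%:M -> `|\det G| = 1 -> (0 < N)%N -> 0 < lam ->
  (forall x : 'rV[int]_N, x != 0 -> lam <= nrm1 (intv R x *m G)) ->
  free [:: intv R u; intv R v] -> y = al *: intv R u + be *: intv R v ->
  lam ^+ (N - 2) * `|(y *m H) 0 i0| <= 64 * (32 * N%:R ^+ 2) ^+ N *
    (nrm1 (y *m H) * nrm1 ((intv R v *m H) 0 i0 *: (intv R u *m H) -
                           (intv R u *m H) 0 i0 *: (intv R v *m H))).
Proof.
move=> GH dG N0 lam0 hlam fy yE.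
have [_ Htu] := mulmx1_unit GH; have Hu : H \in unitmx by rewrite -unitmx_tr.
have fyH : free [:: intv R u *m H; intv R v *m H] := free_mulmx Hu fy.
have [U [T pv]] := pivot_exists fyH.
have uv : intv R u *m H != intv R v *m H.
  by have := free_uniq fyH; rewrite /= inE andbT.
have yHE : y *m H = al *: (intv R u *m H) + be *: (intv R v *m H).
  by rewrite yE mulmxDl -!scalemxAl.
have h1 := pivoted_pair_det i0 uv pv yHE.
have h2 := @pivoted_det_ge N G H [:: u; v] U T lam GH dG N0 isT lam0 hlam pv.
have cU : (#|U| + 2 = N)%N by case: pv.
have -> : (N - 2)%N = #|U| by lia.
apply: le_trans (ler_wpM2r (normr_ge0 _) h2) _; rewrite -[leLHS]mulrA.
apply: ler_wpM2l h1.
by rewrite mulr_ge0 // exprn_ge0 // mulr_ge0 // exprn_ge0.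
Qed.

Section Flow.
Variables (n : nat) (xi : 'I_n -> R).

(** Sends integer rows to lattice points rescaled so that [K(q)] becomes the unit cube. [dual_mx] is
    its inverse transpose: the first coordinate carries the linear form, the others the height. *)
Definition primal_mx (q : R) : 'M[R]_(1 + n) :=
  block_mx (expR (- (n%:R * q)))%:M (expR q *: \row_i xi i) 0 (- expR q)%:M.

Definition dual_mx (q : R) : 'M[R]_(1 + n) :=
  block_mx (expR (n%:R * q))%:M 0 (expR (n%:R * q) *: \col_i xi i) (- expR (- q))%:M.

Lemma primal_dual q : primal_mx q *m (dual_mx q)^T = 1%:M.
Proof.
rewrite /primal_mx /dual_mx tr_block_mx mulmx_block !tr_scalar_mx !trmx0 !mulmx0 !mul0mx.
rewrite !addr0 !add0r -!scalar_mxM -expRD addNr expR0 mulrNN -expRD subrr expR0.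
have -> : (expR (n%:R * q) *: \col_i xi i)^T = expR (n%:R * q) *: \row_i xi i.
  by apply/rowP => i; rewrite !mxE.
rewrite mul_scalar_mx scalerA -expRD addNr expR0 scale1r.
rewrite mul_mx_scalar scalerA mulNr -expRD addNr expR0 scaleN1r.
by rewrite subrr -scalar_mx_block.
Qed.

Lemma primal_det q : `|\det (primal_mx q)| = 1.
Proof.
rewrite /primal_mx det_ublock !det_scalar expr1 normrM normrX normrN.
rewrite !(gtr0_norm (expR_gt0 _)) -expRM_natl -expRD mulr_natl.
by rewrite addNr expR0.
Qed.

Lemma dual_det q : `|\det (dual_mx q)| = 1.
Proof.
have := congr1 (fun A => `|\det A|) (primal_dual q).
by rewrite det_mulmx det_tr normrM primal_det mul1r det1 normr1.
Qed.

Definition lform (y : 'rV[R]_(1 + n)) : R := y 0 (lshift n 0) + \sum_i xi i * y 0 (rshift 1 i).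
Definition height (y : 'rV[R]_(1 + n)) : R := \sum_i `|y 0 (rshift 1 i)|.

Lemma dual_coord0 q (y : 'rV[R]_(1 + n)) : (y *m dual_mx q) 0 (lshift n 0) = expR (n%:R * q) * lform y.
Proof.
rewrite -[in LHS](hsubmxK y) /dual_mx mul_row_block row_mxEl.
rewrite !mxE /lform mulrDr mulr_sumr big_ord1 !mxE eqxx mulr1n mulrC; congr (_ + _).
by apply: eq_bigr => i _; rewrite !mxE; ring.
Qed.

Lemma dual_coordS q (y : 'rV[R]_(1 + n)) i : (y *m dual_mx q) 0 (rshift 1 i) = - expR (- q) * y 0 (rshift 1 i).
Proof.
rewrite -[in LHS](hsubmxK y) /dual_mx mul_row_block row_mxEr mulmx0 add0r.
by rewrite mul_mx_scalar !mxE.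
Qed.

Lemma dual_nrm1 q (y : 'rV[R]_(1 + n)) : nrm1 (y *m dual_mx q) =
  expR (n%:R * q) * `|lform y| + expR (- q) * height y.
Proof.
rewrite /nrm1 big_split_ord /= big_ord1 dual_coord0 normrM (gtr0_norm (expR_gt0 _)).
congr (_ + _); rewrite /height mulr_sumr; apply: eq_bigr => i _.
by rewrite dual_coordS normrM normrN (gtr0_norm (expR_gt0 _)).
Qed.

Lemma primal_nrm1 q (x : 'rV[R]_(1 + n)) : nrm1 (x *m primal_mx q) =
  expR (- (n%:R * q)) * `|x 0 (lshift n 0)| +
  \sum_i expR q * `|xi i * x 0 (lshift n 0) - x 0 (rshift 1 i)|.
Proof.
rewrite /nrm1 big_split_ord /= big_ord1.
rewrite -[in LHS](hsubmxK x) /primal_mx mul_row_block; congr (_ + _).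
  by rewrite row_mxEl mulmx0 addr0 mul_mx_scalar !mxE normrM (gtr0_norm (expR_gt0 _)).
apply: eq_bigr => i _; rewrite row_mxEr mul_mx_scalar -scalemxAr !mxE big_ord1 !mxE.
rewrite mulNr -mulrBr normrM (gtr0_norm (expR_gt0 _)).
by congr (_ * `|_ - _|); rewrite mulrC.
Qed.

Lemma lformD u v : lform (u + v) = lform u + lform v.
Proof.
rewrite /lform mxE addrACA -big_split /=; congr (_ + _).
by apply: eq_bigr => i _; rewrite mxE mulrDr.
Qed.

Lemma lformZ c u : lform (c *: u) = c * lform u.
Proof.
rewrite /lform mxE mulrDr mulr_sumr; congr (_ + _).
by apply: eq_bigr => i _; rewrite mxE mulrCA.
Qed.

Lemma heightZ c u : height (c *: u) = `|c| * height u.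
Proof.
by rewrite /height mulr_sumr; apply: eq_bigr => i _; rewrite mxE normrM.
Qed.

Lemma heightB u v : height (u - v) <= height u + height v.
Proof.
rewrite /height -big_split /=; apply: ler_sum => i _.
by rewrite !mxE; exact: ler_normB.
Qed.

Lemma height_ge0 u : 0 <= height u.
Proof. exact: sumr_ge0. Qed.

Lemma dual_wedge_nrm1 q (u v : 'rV[R]_(1 + n)) :
  nrm1 ((v *m dual_mx q) 0 (lshift n 0) *: (u *m dual_mx q) -
        (u *m dual_mx q) 0 (lshift n 0) *: (v *m dual_mx q)) <=
  expR (n%:R * q - q) * (`|lform v| * height u + `|lform u| * height v).
Proof.
rewrite !scalemxAl -mulmxBl dual_nrm1 !dual_coord0 -!scalerA -scalerBr.
rewrite lformZ heightZ -scaleN1r lformD !lformZ scaleN1r.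
have -> : lform v * lform u + -1 * (lform u * lform v) = 0 by ring.
rewrite mulr0 normr0 mulr0 add0r (gtr0_norm (expR_gt0 _)) mulrA -expRD.
rewrite [- q + _]addrC ler_pM2l ?expR_gt0 //.
by apply: le_trans (heightB _ _) _; rewrite !heightZ.
Qed.

End Flow.
End Lattice.

(** * Three dual vectors around a peak of the last minimum *)

Section Core.
Variable R : realType.

(** Choose a nonzero integer vector of least l1 norm in the ball: a nonzero integer multiple with
    [|c| < 1] would lie in the ball and be smaller. *)
Lemma primitive_in_ball (N : nat) (H : 'M[R]_N) (y0 : 'rV[int]_N) B :
  y0 != 0 -> nrm1 (intv R y0 *m H) <= B ->
  exists y : 'rV[int]_N, [/\ y != 0, nrm1 (intv R y *m H) <= B &
    forall (y' : 'rV[int]_N) c, y' != 0 -> intv R y' = c *: intv R y -> 1 <= `|c|].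
Proof.
move=> y00 y0B.
pose sz (y : 'rV[int]_N) := (\sum_j absz (y ord0 j))%N.
have szE y : (sz y)%:R = nrm1 (intv R y).
  by rewrite /sz natr_sum /nrm1; apply: eq_bigr => j _; rewrite mxE natr_absz intr_norm.
pose P m := `[< exists y : 'rV[int]_N, [/\ y != 0, nrm1 (intv R y *m H) <= B & sz y = m] >].
have exP : exists m, P m by exists (sz y0); apply/asboolP; exists y0.
case: (ex_minnP exP) => m /asboolP[y [yn0 yB ym]] mmin.
exists y; split=> // y' c y'0 y'E; rewrite leNgt; apply/negP => c1.
have : (m <= sz y')%N.
  apply: mmin; apply/asboolP; exists y'; split=> //.
  rewrite y'E -scalemxAl nrm1Z; apply: le_trans yB.
  by rewrite ler_piMl ?nrm1_ge0 // ltW.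
rewrite -(ler_nat R) szE -ym szE y'E nrm1Z leNgt => /negP; apply.
by rewrite gtr_pMl // lt_def nrm1_ge0 nrm1_eq0 intv_eq0 yn0.
Qed.

Variables (n : nat) (xi : 'I_n -> R).

Definition good (th s : R) (z : 'rV[int]_(1 + n)) :=
  z != 0 /\ nrm1 (intv R z *m dual_mx xi s) <= expR (- (th * s)).

Lemma good_form th s z : good th s z ->
  `|lform xi (intv R z)| <= expR (- ((n%:R + th) * s)).
Proof.
case=> _; rewrite dual_nrm1 => h.
rewrite -(ler_pM2l (expR_gt0 (n%:R * s))) -expRD.
have -> : n%:R * s + - ((n%:R + th) * s) = - (th * s) by ring.
apply: le_trans h; rewrite lerDl mulr_ge0 ?expR_ge0 //; exact: height_ge0.
Qed.

Lemma good_height th s z : good th s z ->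
  height (intv R z) <= expR ((1 - th) * s).
Proof.
case=> _; rewrite dual_nrm1 => h.
rewrite -(ler_pM2l (expR_gt0 (- s))) -expRD.
have -> : - s + (1 - th) * s = - (th * s) by ring.
by apply: le_trans h; rewrite lerDr mulr_ge0 ?expR_ge0.
Qed.

Lemma good_dual_nrm1 th s p z : good th s z -> p <= s ->
  nrm1 (intv R z *m dual_mx xi p) <= 2 * expR ((1 - th) * s - p).
Proof.
move=> gz ps; rewrite dual_nrm1 mulr2n mulrDl mul1r; apply: lerD.
  apply: le_trans (ler_wpM2l (expR_ge0 _) (good_form gz)) _.
  rewrite -expRD ler_expR -subr_ge0.
  have -> : (1 - th) * s - p - (n%:R * p + - ((n%:R + th) * s)) = (n%:R + 1) * (s - p) by ring.
  by rewrite mulr_ge0 ?subr_ge0 // addr_ge0.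
apply: le_trans (ler_wpM2l (expR_ge0 _) (good_height gz)) _.
by rewrite -expRD ler_expR addrC.
Qed.

(* The first coordinate of [u *m dual_mx xi q] is the value of the linear form, so the
   wedge [u /\ v] is measured by [|lform v| height u + |lform u| height v]. *)
Lemma wedge_lower (q lam : R) (u v : 'rV[int]_(1 + n)) (y : 'rV[R]_(1 + n)) :
  0 < lam -> (forall x, x != 0 -> lam <= nrm1 (intv R x *m primal_mx xi q)) ->
  free [:: intv R u; intv R v] -> y \in <<[:: intv R u; intv R v]>>%VS ->
  lam ^+ (n - 1) * (expR (n%:R * q) * `|lform xi y|) <=
  64 * (32 * (1 + n)%:R ^+ 2) ^+ (1 + n) * (nrm1 (y *m dual_mx xi q) *
   (expR (n%:R * q - q) * (`|lform xi (intv R v)| * height (intv R u) +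
      `|lform xi (intv R u)| * height (intv R v)))).
Proof.
move=> lam0 hlam fuv.
rewrite span_cons span_seq1 => /memv_addP[_ /vlineP[al ->] [_ /vlineP[be ->] yE]].
have := pair_lower (lshift n 0) (primal_dual xi q) (primal_det xi q) isT lam0 hlam fuv yE.
rewrite dual_coord0 normrM (gtr0_norm (expR_gt0 _)) => /le_trans; apply.
apply: ler_wpM2l; first by rewrite mulr_ge0 // exprn_ge0 // mulr_ge0 // exprn_ge0.
by apply: ler_wpM2l; [exact: nrm1_ge0 | exact: dual_wedge_nrm1].
Qed.

(** The form value may be smaller than the peak [p0] predicts, so [p] is redefined from the form
    value itself. It falls below [p0] by at most a factor [1 - e], and the height bound survives at
    the cost of [4 e]. *)
Lemma peak_vector (t e P : R) :
  (1 < n)%N -> 0 < e -> 2 * e < t -> t + 2 * e < 1 -> 0 <= P ->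
  (forall Q, exists2 p, Q < p & exists y, good (t - e) p y) ->
  (forall y : 'rV[int]_(1 + n), y != 0 -> lform xi (intv R y) != 0) ->
  exists p (y : 'rV[int]_(1 + n)), [/\ P < p /\ y != 0,
    `|lform xi (intv R y)| = expR (- ((n%:R + t) * p)),
    height (intv R y) <= expR ((1 - t + 4 * e) * p) &
    forall (y' : 'rV[int]_(1 + n)) c, y' != 0 -> intv R y' = c *: intv R y -> 1 <= `|c|].
Proof.
move=> n1 e0 et te P0 E3 fn0.
have n2 : 2 <= n%:R :> R by rewrite (ler_nat R 2 n).
have [p0 Pp0 [y0 [y00 y0B]]] := E3 (2 * P).
have [y [yn0 yB yprim]] := primitive_in_ball y00 y0B.
have gy0 : good (t - e) p0 y by [].
pose p := - ln `|lform xi (intv R y)| / (n%:R + t).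
have nt0 : 0 < n%:R + t by lra.
have fy : `|lform xi (intv R y)| = expR (- ((n%:R + t) * p)).
  rewrite /p mulrC divfK ?gt_eqF // opprK lnK // posrE normr_gt0; exact: fn0.
clearbody p.
have p00 : 0 <= p0 by lra.
have pp0 : (1 - e) * p0 <= p.
  have := good_form gy0; rewrite fy ler_expR lerN2 => h.
  rewrite -(ler_pM2l nt0); apply: le_trans h; rewrite -subr_ge0.
  have -> : (n%:R + (t - e)) * p0 - (n%:R + t) * ((1 - e) * p0) = e * p0 * (n%:R + t - 1) by ring.
  by rewrite !mulr_ge0 //; lra.
have p0p : p0 <= 2 * p.
  have e2 : e <= 1 / 2 by lra.
  have := ler_wpM2r p00 e2; lra.
exists p, y; split=> //; first by split=> //; lra.
apply: le_trans (good_height gy0) _; rewrite ler_expR.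
have t4 : 0 <= 1 - t + 4 * e by lra.
apply: le_trans (ler_wpM2l t4 pp0); rewrite -subr_ge0.
have -> : (1 - t + 4 * e) * ((1 - e) * p0) - (1 - (t - e)) * p0 = e * p0 * (2 + t - 4 * e) by ring.
by rewrite !mulr_ge0 //; lra.
Qed.

Lemma peak_dual_nrm1 (t e p : R) (y : 'rV[R]_(1 + n)) :
  0 <= e -> 0 <= p -> 2 <= expR (e * p) ->
  `|lform xi y| = expR (- ((n%:R + t) * p)) ->
  height y <= expR ((1 - t + 4 * e) * p) ->
  nrm1 (y *m dual_mx xi p) <= expR (- ((t - 5 * e) * p)).
Proof.
move=> e0 p0 ep fy Yy; rewrite dual_nrm1 fy.
have h := ler_wpM2l (expR_ge0 (- p)) Yy.
rewrite -expRD in h; rewrite -expRD.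
have -> : - ((t - 5 * e) * p) = e * p + (- p + (1 - t + 4 * e) * p) by ring.
rewrite [leRHS]expRD.
have h2 : expR (n%:R * p + - ((n%:R + t) * p)) <= expR (- p + (1 - t + 4 * e) * p).
  rewrite ler_expR -subr_ge0.
  have -> : - p + (1 - t + 4 * e) * p - (n%:R * p + - ((n%:R + t) * p)) = 4 * (e * p) by ring.
  by rewrite !mulr_ge0.
have := ler_wpM2r (expR_ge0 (- p + (1 - t + 4 * e) * p)) ep; lra.
Qed.

(** At time [s2] the form part of [v] is at most [e^{-(t+2e) s2}], less than half of what the upper
    limit [t] demands, so the height part must supply the rest. *)
Lemma height_lower (t th e s s2 : R) (v : 'rV[int]_(1 + n)) :
  2 <= expR (e * s2) -> (n%:R + t + 2 * e) * s2 = (n%:R + th) * s ->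
  expR (- ((t + e) * s2)) <= nrm1 (intv R v *m dual_mx xi s2) -> good th s v ->
  expR ((1 - t - 2 * e) * s2) <= height (intv R v).
Proof.
move=> K2 s2E h gv; rewrite dual_nrm1 in h.
have h1 := ler_wpM2l (expR_ge0 (n%:R * s2)) (good_form gv).
rewrite -expRD in h1.
have e1 : n%:R * s2 + - ((n%:R + th) * s) = - ((t + 2 * e) * s2).
  rewrite -s2E; ring.
rewrite e1 in h1.
have e2 : - ((t + e) * s2) = e * s2 + - ((t + 2 * e) * s2) by ring.
rewrite e2 expRD in h.
have h3 : expR (- ((t + 2 * e) * s2)) <= expR (- s2) * height (intv R v).
  have := ler_wpM2r (expR_ge0 (- ((t + 2 * e) * s2))) K2; lra.
rewrite -(ler_pM2l (expR_gt0 (- s2))) -expRD; apply: le_trans h3.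
by rewrite ler_expR; lra.
Qed.

Lemma good_not_multiple (th s r : R) (v u : 'rV[int]_(1 + n)) :
  (forall (v' : 'rV[int]_(1 + n)) c, v' != 0 -> intv R v' = c *: intv R v -> 1 <= `|c|) ->
  good th s u ->
  expR (- ((n%:R + th) * s)) < `|lform xi (intv R v)| \/
  expR ((1 - th) * s) < height (intv R v) ->
  intv R u \notin << [:: intv R v] >>%VS.
Proof.
move=> vprim gu hv; rewrite span_seq1; apply/negP => /vlineP[c uE].
have c1 := vprim _ _ gu.1 uE.
have := good_form gu; have := good_height gu; rewrite uE heightZ lformZ normrM.
case: hv => hv h1 h2.
  have h3 : `|lform xi (intv R v)| <= `|c| * `|lform xi (intv R v)| by rewrite ler_peMl.
  by have := lt_le_trans hv (le_trans h3 h2); rewrite ltxx.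
have h3 : height (intv R v) <= `|c| * height (intv R v) by rewrite ler_peMl // height_ge0.
by have := lt_le_trans hv (le_trans h3 h1); rewrite ltxx.
Qed.

Lemma wedge_exponents (th e s sg : R) (u v : 'rV[int]_(1 + n)) :
  0 <= e -> 0 <= th - e -> 0 <= sg -> sg <= s ->
  height (intv R v) = expR ((1 - th + 2 * e) * sg) ->
  good (th - e) s v -> good (th - e) sg u ->
  `|lform xi (intv R v)| * height (intv R u) + `|lform xi (intv R u)| * height (intv R v)
      <= 2 * expR ((1 - n%:R - 2 * th + 3 * e) * sg).
Proof.
move=> e0 the sg0 sgs sgE gv gu; rewrite mulr2n mulrDl mul1r; apply: lerD.
  apply: le_trans (ler_pM _ _ (good_form gv) (good_height gu)) _ => //; first exact: height_ge0.
  rewrite -expRD ler_expR.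
  have := mulr_ge0 e0 sg0.
  have nte0 : 0 <= n%:R + th - e by rewrite -addrA addr_ge0.
  have := ler_wpM2l nte0 sgs; lra.
rewrite sgE; apply: le_trans (ler_wpM2r (expR_ge0 _) (good_form gu)) _.
by rewrite -expRD ler_expR; lra.
Qed.

(** [t] cancels: at the peak, the form coordinate of [y] on one side and its norm on the other have
    the same exponent up to [O(e)]. *)
Lemma wedge_comparison (t th mu e p s sg K : R) (u v y : 'rV[int]_(1 + n)) :
  (0 < n)%N -> K = 64 * (32 * (1 + n)%:R ^+ 2) ^+ (1 + n) ->
  0 <= e -> 0 <= th - e -> 0 <= sg -> sg <= s ->
  K + 2 <= expR (e * p) ->
  (forall x : 'rV[int]_(1 + n), x != 0 ->
     expR ((mu - e) * p) <= nrm1 (intv R x *m primal_mx xi p)) ->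
  `|lform xi (intv R y)| = expR (- ((n%:R + t) * p)) ->
  nrm1 (intv R y *m dual_mx xi p) <= expR (- ((t - 5 * e) * p)) ->
  height (intv R v) = expR ((1 - th + 2 * e) * sg) ->
  good (th - e) s v -> good (th - e) sg u ->
  free [:: intv R u; intv R v] -> intv R y \in << [:: intv R u; intv R v] >>%VS ->
  (n%:R - 1 + 2 * th - 3 * e) * sg <= ((n%:R - 1) * (1 - mu) + (n%:R + 6) * e) * p.
Proof.
move=> n0 KE e0 the sg0 sgs pK E4 fy Fy sgE gv gu freeuv yuv.
have K0 : 0 < K.
  by rewrite KE mulr_gt0 // exprn_gt0 // mulr_gt0 // exprn_gt0 // ltr0n.
have W := wedge_exponents e0 the sg0 sgs sgE gv gu.
have := wedge_lower (expR_gt0 _) E4 freeuv yuv.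
rewrite -KE fy -expRM_natl -!expRD => h.
have KL : K <= expR (e * p) by clear -pK; lra.
have tL : 2 <= expR (e * p) by clear -pK K0; lra.
have Wl := le_trans W (ler_wpM2r (expR_ge0 _) tL).
have h2 : expR ((n - 1)%:R * ((mu - e) * p) + (n%:R * p + - ((n%:R + t) * p))) <=
   expR (e * p) * (expR (- ((t - 5 * e) * p)) * (expR (n%:R * p - p) *
     (expR (e * p) * expR ((1 - n%:R - 2 * th + 3 * e) * sg)))).
  have Wp : 0 <= `|lform xi (intv R v)| * height (intv R u) + `|lform xi (intv R u)| * height (intv R v).
    by rewrite addr_ge0 // mulr_ge0 // height_ge0.
  have Wq := mulr_ge0 (expR_ge0 (n%:R * p - p)) Wp.
  apply: le_trans h _; apply: ler_pM KL _; first exact: ltW.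
    exact: mulr_ge0 (nrm1_ge0 _) Wq.
  apply: ler_pM Fy _ => //; first exact: nrm1_ge0.
  by apply: ler_wpM2l; first exact: expR_ge0.
move: h2; rewrite -!expRD ler_expR (natrB _ n0) => h2.
by clear -h2; lra.
Qed.

(** Suppose all good forms between [q] and [vs * p] stay in the plane. The form [v] good at [vs * p]
    is high, because the last minimum stays below [t]. At the earlier time [sg], where [v] is still
    slightly too high, another form [u] of the plane is good. The first numerical hypothesis puts
    [sg] after [q]; the wedge bound for [u, v] caps [sg], against the second. *)
Lemma outside_vector (t th mu e vs p q K : R) (y y' : 'rV[int]_(1 + n)) :
  (1 < n)%N -> K = 64 * (32 * (1 + n)%:R ^+ 2) ^+ (1 + n) ->
  0 < e -> 2 * e < th -> th <= t -> t + 2 * e < 1 -> 1 <= vs -> 0 < p ->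
  (1 - th + 2 * e) * (n%:R + t + 2 * e) * (n%:R + t) <
    (1 - t - 2 * e) * (n%:R + th - e) * vs * (n%:R + th - 2 * e) ->
  (1 - th + 2 * e) * (n%:R + t + 2 * e) * ((n%:R - 1) * (1 - mu) + (n%:R + 6) * e) <
    (1 - t - 2 * e) * (n%:R + th - e) * vs * (n%:R - 1 + 2 * th - 3 * e) ->
  (n%:R + th - 2 * e) * q = (n%:R + t) * p -> p <= q ->
  (forall r, p <= r -> exists z, good (th - e) r z) ->
  (forall r, p / 2 <= r -> K + 2 <= expR (e * r) /\ forall z : 'rV[int]_(1 + n), z != 0 ->
     expR (- ((t + e) * r)) <= nrm1 (intv R z *m dual_mx xi r)) ->
  (forall x : 'rV[int]_(1 + n), x != 0 ->
     expR ((mu - e) * p) <= nrm1 (intv R x *m primal_mx xi p)) ->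
  `|lform xi (intv R y)| = expR (- ((n%:R + t) * p)) ->
  nrm1 (intv R y *m dual_mx xi p) <= expR (- ((t - 5 * e) * p)) ->
  free [:: intv R y'; intv R y] ->
  exists s' z, [/\ q <= s', s' <= vs * p, good (th - e) s' z &
    intv R z \notin << [:: intv R y'; intv R y] >>%VS].
Proof.
move=> n1 KE e0 eth tht te vs1 p0 C1 C2 qE pq E1 E2 E4 fy Fy freey.
have n2 : 2 <= n%:R :> R by rewrite (ler_nat R 2 n).
pose s := vs * p.
have ps : p <= s by rewrite /s ler_peMl // ltW.
apply: contrapT => H.
have inE s' z : q <= s' -> s' <= s -> good (th - e) s' z ->
    intv R z \in << [:: intv R y'; intv R y] >>%VS.
  by move=> h1 h2 h3; apply/negPn/negP => h4; apply: H; exists s', z.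
have [v0 [v00 v0B]] := E1 s ps.
have [v [vn0 vB vprim]] := primitive_in_ball v00 v0B.
have gv : good (th - e) s v by [].
pose s2 := (n%:R + th - e) * s / (n%:R + t + 2 * e).
have nt2 : 0 < n%:R + t + 2 * e by clear -n2 e0 eth tht; lra.
have nte : n%:R <= n%:R + th - e by clear -eth e0; lra.
have s2E : (n%:R + t + 2 * e) * s2 = (n%:R + th - e) * s by rewrite /s2 mulrC divfK // gt_eqF.
(* [s2] may precede [p], which is why the dual lower bound is assumed from [p / 2] on. *)
have s2p : p / 2 <= s2.
  rewrite /s2 ler_pdivlMr //.
  have a1 : n%:R * p <= (n%:R + th - e) * s by apply: ler_pM => //; exact: ltW.
  have a2 : n%:R + t + 2 * e <= 2 * n%:R by clear -te n2; lra.
  have := ler_wpM2r (ltW p0) a2; clear -a1; lra.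
have K0 : 0 < K.
  by rewrite KE mulr_gt0 // exprn_gt0 // mulr_gt0 // exprn_gt0 // ltr0n.
have [s2K s2F] := E2 s2 s2p.
have Vlow : expR ((1 - t - 2 * e) * s2) <= height (intv R v).
  apply: (height_lower _ _ (s2F v vn0) gv); first by clear -s2K K0; lra.
  by rewrite s2E addrA.
have V0 : 0 < height (intv R v) by apply: lt_le_trans Vlow; exact: expR_gt0.
have th2 : 0 < 1 - th + 2 * e by clear -te tht e0; lra.
(* At time [sg] the height of [v] exceeds the one allowed to a good form by a factor [e^{e sg}]. *)
pose sg := ln (height (intv R v)) / (1 - th + 2 * e).
have sgE : height (intv R v) = expR ((1 - th + 2 * e) * sg).
  by rewrite /sg mulrC divfK ?gt_eqF // lnK.
clearbody sg.
have s0 : 0 <= s := le_trans (ltW p0) ps.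
have sgs : sg <= s.
  have := good_height gv; rewrite sgE ler_expR => h.
  rewrite -(ler_pM2l th2).
  have := mulr_ge0 (ltW e0) s0; clear -h; lra.
have sglow : (1 - t - 2 * e) * (n%:R + th - e) * vs * p <= (1 - th + 2 * e) * (n%:R + t + 2 * e) * sg.
  have := Vlow; rewrite sgE ler_expR => h.
  have -> : (1 - t - 2 * e) * (n%:R + th - e) * vs * p = (1 - t - 2 * e) * ((n%:R + th - e) * s).
    by rewrite /s; ring.
  rewrite -s2E; have := ler_wpM2l (ltW nt2) h; clear; lra.
have nth0 : 0 < n%:R + th - 2 * e by clear -n2 eth; lra.
have c0 : 0 < (1 - th + 2 * e) * (n%:R + t + 2 * e) by rewrite mulr_gt0.
have qsg : q <= sg.
  have c1 : (1 - th + 2 * e) * (n%:R + t + 2 * e) * (n%:R + t) * p <=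
     (1 - t - 2 * e) * (n%:R + th - e) * vs * (n%:R + th - 2 * e) * p.
    by rewrite ler_pM2r // ltW.
  have c2 : (1 - th + 2 * e) * (n%:R + t + 2 * e) * ((n%:R + th - 2 * e) * q) <=
     (1 - th + 2 * e) * (n%:R + t + 2 * e) * ((n%:R + th - 2 * e) * sg).
    rewrite qE mulrA; apply: le_trans c1 _.
    by rewrite -[leLHS]mulrA -[leRHS]mulrA ![(n%:R + th - 2 * e) * _]mulrC !mulrA ler_pM2r.
  by move: c2; rewrite ler_pM2l // ler_pM2l.
have sg0 : 0 < sg by apply: lt_le_trans p0 (le_trans pq qsg).
have [u gu] := E1 sg (le_trans pq qsg).
have uv : intv R u \notin << [:: intv R v] >>%VS.
  apply: (good_not_multiple _ vprim gu); first exact: 0.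
  right; rewrite sgE ltr_expR.
  have := mulr_gt0 e0 sg0; clear; lra.
have freeuv : free [:: intv R u; intv R v].
  by rewrite free_cons uv seq1_free intv_eq0 vn0.
have yuv : intv R y \in << [:: intv R u; intv R v] >>%VS.
  have sub : (<< [:: intv R u; intv R v] >> <= << [:: intv R y'; intv R y] >>)%VS.
    apply/span_subvP => w; rewrite !in_cons in_nil orbF => /orP[] /eqP ->.
      exact: (inE sg).
    by apply: (inE s) => //; exact: le_trans qsg sgs.
  have : (<< [:: intv R u; intv R v] >> == << [:: intv R y'; intv R y] >>)%VS.
    by rewrite eqEdim sub (eqP freeuv) (eqP freey).
  by move/eqP => ->; apply: memv_span; rewrite !in_cons eqxx orbT.
have the0 : 0 <= th - e by clear -eth e0; lra.
have p2 : p / 2 <= p by clear -p0; lra.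
have [pK _] := E2 p p2.
have h3 := wedge_comparison (ltnW n1) KE (ltW e0) the0 (ltW sg0) sgs pK E4 fy Fy sgE gv gu freeuv yuv.
have c4 : 0 <= n%:R - 1 + 2 * th - 3 * e by clear -n2 eth e0; lra.
move: C2; rewrite -(ltr_pM2r p0) ltNge => /negP; apply.
apply: (@le_trans _ _ ((1 - th + 2 * e) * (n%:R + t + 2 * e) * sg * (n%:R - 1 + 2 * th - 3 * e))).
  by have := ler_wpM2r c4 sglow; clear; lra.
by have := ler_wpM2l (ltW c0) h3; clear; lra.
Qed.

(** The conclusion compares exponents in the product bound for [z, y', y] at time [p]; the factor
    [n + th - 2 e] eliminates [q]. *)
Lemma core_eps (t th mu e vs : R) :
  (1 < n)%N ->
  (exists Q, forall q, Q < q -> exists y, good (th - e) q y) ->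
  (exists Q, forall q, Q < q -> forall y : 'rV[int]_(1 + n), y != 0 ->
     expR (- ((t + e) * q)) <= nrm1 (intv R y *m dual_mx xi q)) ->
  (forall Q, exists2 p, Q < p & exists y, good (t - e) p y) ->
  (exists Q, forall q, Q < q -> forall x : 'rV[int]_(1 + n), x != 0 ->
     expR ((mu - e) * q) <= nrm1 (intv R x *m primal_mx xi q)) ->
  (forall y : 'rV[int]_(1 + n), y != 0 -> lform xi (intv R y) != 0) ->
  0 < e -> 2 * e < th -> th <= t -> t + 2 * e < 1 -> 1 <= vs ->
  (1 - th + 2 * e) * (n%:R + t + 2 * e) * (n%:R + t) <
    (1 - t - 2 * e) * (n%:R + th - e) * vs * (n%:R + th - 2 * e) ->
  (1 - th + 2 * e) * (n%:R + t + 2 * e) * ((n%:R - 1) * (1 - mu) + (n%:R + 6) * e) <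
    (1 - t - 2 * e) * (n%:R + th - e) * vs * (n%:R - 1 + 2 * th - 3 * e) ->
  (n%:R + th - 2 * e) * ((n%:R - 2) * (mu - e) + t + 2 - 8 * e) <=
    (1 - th + e) * (vs * (n%:R + th - 2 * e) + (n%:R + t)).
Proof.
move=> n1 [Q1 E1] [Q2 E2] E3 [Q4 E4] fn0 e0 eth tht te vs1 C1 C2.
have n2 : 2 <= n%:R :> R by rewrite (ler_nat R 2 n).
have [K KE] : exists K : R, K = 64 * (32 * (1 + n)%:R ^+ 2) ^+ (1 + n) by exists (64 * (32 * (1 + n)%:R ^+ 2) ^+ (1 + n)).
have K0 : 0 < K.
  by rewrite KE mulr_gt0 // exprn_gt0 // mulr_gt0 // exprn_gt0 // ltr0n.
have [P [P0 large]] : exists P : R, 0 < P /\ forall r, P / 2 < r ->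
    [/\ Q1 < r, Q2 < r, Q4 < r & K + 2 <= expR (e * r)].
  have Ke0 : 0 < (K + 2) / e by rewrite divr_gt0 //; clear -K0; lra.
  exists (2 * (`|Q1| + `|Q2| + `|Q4| + (K + 2) / e)); split.
    by clear -Ke0; have := normr_ge0 Q1; have := normr_ge0 Q2; have := normr_ge0 Q4; lra.
  move=> r Pr; have := ler_norm Q1; have := ler_norm Q2; have := ler_norm Q4.
  have := normr_ge0 Q1; have := normr_ge0 Q2; have := normr_ge0 Q4.
  move=> a1 a2 a3 b1 b2 b3.
  have c1 : (K + 2) / e < r by clear -a1 a2 a3 Pr; lra.
  clear -a1 a2 a3 b1 b2 b3 c1 Pr Ke0 e0; split; try lra.
  apply: le_trans (expR_ge1Dx _).
  by move: c1; rewrite ltr_pdivrMr //; lra.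
have et : 2 * e < t := lt_le_trans eth tht.
have [p [y [[Pp yn0] fy Yy yprim]]] := peak_vector n1 e0 et te (ltW P0) E3 fn0.
have p0 : 0 < p := lt_trans P0 Pp.
have [|pQ1 pQ2 pQ4 pK] := large p; first by clear -Pp p0; lra.
have ep2 : 2 <= expR (e * p) by clear -pK K0; lra.
have Fy := peak_dual_nrm1 (ltW e0) (ltW p0) ep2 fy Yy.
have nth0 : 0 < n%:R + th - 2 * e by clear -n2 eth; lra.
(* At this time the form value of [y] exceeds the allowed one by a factor [e^{e q}], so a good [y']
   is independent of [y]. *)
have [q qE] : exists q, (n%:R + th - 2 * e) * q = (n%:R + t) * p.
  by exists ((n%:R + t) * p / (n%:R + th - 2 * e)); rewrite mulrC divfK // gt_eqF.
have pq : p <= q.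
  by rewrite -(ler_pM2l nth0) qE ler_pM2r //; clear -tht e0; lra.
have q0 : 0 < q := lt_le_trans p0 pq.
have [y' gy'] : exists y', good (th - e) q y' := E1 q (lt_le_trans pQ1 pq).
have fyy' : intv R y' \notin << [:: intv R y] >>%VS.
  apply: (good_not_multiple _ yprim gy'); first exact: 0.
  left; rewrite fy ltr_expR ltrN2 -qE.
  have := mulr_gt0 e0 q0; clear; lra.
have Fy' := good_dual_nrm1 gy' pq.
have freey : free [:: intv R y'; intv R y].
  by rewrite free_cons fyy' seq1_free intv_eq0 yn0.
have [||s' [z [qs' s's gz zE]]] :=
    outside_vector n1 KE e0 eth tht te vs1 p0 C1 C2 qE pq _ _ (E4 p pQ4) fy Fy freey.
- by move=> r pr; apply: E1; exact: lt_le_trans pQ1 pr.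
- move=> r pr; have [|_ rQ2 _ rK] := large r; first by clear -Pp pr; lra.
  by split=> // z0; exact: E2.
have free3 : free [seq intv R y | y <- [:: z; y'; y]].
  by rewrite /= free_cons zE.
have Fz := good_dual_nrm1 gz (le_trans pq qs').
have := @prod_lower R _ _ _ [:: z; y'; y] _ (primal_dual xi p) (primal_det xi p) isT isT
   (expR_gt0 _) (E4 p pQ4) free3.
rewrite -KE !big_cons big_nil mulr1 /= -expRM_natl -[3%N]/(1 + 2)%N subnDl => h.
have KL : K <= expR (e * p) by clear -pK; lra.
have h2 : expR ((n - 2)%:R * ((mu - e) * p)) <= expR (e * p) *
   ((expR (e * p) * expR ((1 - (th - e)) * s' - p)) *
    ((expR (e * p) * expR ((1 - (th - e)) * q - p)) * expR (- ((t - 5 * e) * p)))).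
  have le2 a : 2 * expR a <= expR (e * p) * expR a by rewrite ler_wpM2r // expR_ge0.
  have F0 (w : 'rV[R]_(1 + n)) : 0 <= nrm1 w := nrm1_ge0 w.
  apply: le_trans h _; apply: ler_pM KL _; first exact: ltW.
    by apply: mulr_ge0 (F0 _) (mulr_ge0 (F0 _) (F0 _)).
  apply: ler_pM (le_trans Fz (le2 _)) _; first exact: F0.
    exact: mulr_ge0 (F0 _) (F0 _).
  exact: ler_pM (F0 _) (F0 _) (le_trans Fy' (le2 _)) Fy.
move: h2; rewrite -!expRD ler_expR natrB // => h2.
have th1 : 0 <= 1 - th + e by clear -te tht e0; lra.
have h3 := ler_wpM2l th1 s's.
have h4 : p * ((n%:R - 2) * (mu - e) + t + 2 - 8 * e) <= (1 - th + e) * (vs * p + q).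
  by clear -h3 h2; lra.
rewrite -(ler_pM2r p0); apply: (@le_trans _ _ ((n%:R + th - 2 * e) * ((1 - th + e) * (vs * p + q)))).
  by rewrite -[leLHS]mulrA ler_pM2l // [_ * p]mulrC.
have -> : (n%:R + th - 2 * e) * ((1 - th + e) * (vs * p + q)) =
  (1 - th + e) * (vs * (n%:R + th - 2 * e) * p + (n%:R + th - 2 * e) * q) by ring.
by rewrite qE le_eqVlt; apply/orP; left; apply/eqP; ring.
Qed.

End Core.

(** * Letting the error exponent tend to zero *)

Section Limit.
Variable R : realType.

Lemma horner_gt0_near0 (p : {poly R}) : 0 < p.[0] ->
  exists2 d, 0 < d & forall e, 0 < e -> e < d -> 0 < p.[e].
Proof.
move=> p0.
have : \forall e \near (0 : R), 0 < p.[e].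
  exact: (cvgr_gt _ (@continuous_horner _ p 0)).
move=> /nbhs_ballP[d /= d0 H]; exists d => // e e0 ed; apply: H.
by rewrite /ball /= sub0r normrN gtr0_norm.
Qed.

Variables (n : nat) (xi : 'I_n -> R).

Lemma core_limit (t th mu : R) :
  (1 < n)%N ->
  (forall e, 0 < e -> exists Q, forall q, Q < q -> exists y, good xi (th - e) q y) ->
  (forall e, 0 < e -> exists Q, forall q, Q < q -> forall y : 'rV[int]_(1 + n), y != 0 ->
     expR (- ((t + e) * q)) <= nrm1 (intv R y *m dual_mx xi q)) ->
  (forall e, 0 < e -> forall Q, exists2 p, Q < p & exists y, good xi (t - e) p y) ->
  (forall e, 0 < e -> exists Q, forall q, Q < q -> forall x : 'rV[int]_(1 + n), x != 0 ->
     expR ((mu - e) * q) <= nrm1 (intv R x *m primal_mx xi q)) ->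
  (forall y : 'rV[int]_(1 + n), y != 0 -> lform xi (intv R y) != 0) ->
  0 < th -> th <= t -> t < 1 ->
  (n%:R - 1) * mu * (n%:R + th) = - (n%:R - 1) * t - th * (n%:R + 1 + 2 * t) ->
  (1 - t) * (1 - mu) * (n%:R + th) ^+ 2 <= (1 - th) ^+ 2 * (n%:R + t) ^+ 2.
Proof.
move=> n1 E1 E2 E3 E4 fn0 th0 tht t1 rel.
have n2 : 2 <= n%:R :> R by rewrite (ler_nat R 2 n).
rewrite leNgt; apply/negP => lt.
set N : R := n%:R in n2 rel lt *.
pose a := (1 - t) * (N + th) ^+ 2; pose b := (1 - th) * (N + t) ^+ 2.
have a0 : 0 < a by rewrite mulr_gt0 ?exprn_gt0 //; lra.
have c0 : 0 < 1 - th by lra.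
have bd : b / a < (1 - mu) / (1 - th).
  rewrite ltr_pdivrMr // mulrAC ltr_pdivlMr //.
  by move: lt; rewrite /a /b !expr2; clear; lra.
(* [vs * p] separates the two bounds for the time at which the plane of [y, y'] is left *)
pose vs := (b / a + (1 - mu) / (1 - th)) / 2.
have vlo : b < vs * a by rewrite -ltr_pdivrMr // /vs; clear -bd; lra.
have vhi : vs * (1 - th) < 1 - mu by rewrite -ltr_pdivlMr // /vs; clear -bd; lra.
clearbody vs.
have ab : a <= b.
  rewrite /a /b !expr2; apply: ler_pM; rewrite ?mulr_ge0 //; try (clear -t1 tht th0 n2; lra).
  by apply: ler_pM; clear -t1 tht th0 n2; lra.
have vs1 : 1 <= vs.
  by rewrite -(ler_pM2r a0) mul1r; apply: le_trans ab (ltW vlo).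
(* The prescribed value of [th] enters here: by this identity the second numerical requirement at
   [e = 0] is a positive multiple of the first. *)
have rel2 : (N + t) * (N - 1 + 2 * th) = (N - 1) * (1 - mu) * (N + th).
  have -> : (N - 1) * (1 - mu) * (N + th) = (N - 1) * (N + th) - (N - 1) * mu * (N + th) by ring.
  by rewrite rel; ring.
(* [p1] and [p2] are the numerical hypotheses of [core_eps] as polynomials in the error exponent,
   [p3] the negation of its conclusion; positivity at 0 persists nearby. *)
pose p1 : {poly R} := ((1 - t)%:P - 2%:P * 'X) * ((N + th)%:P - 'X) * vs%:P * ((N + th)%:P - 2%:P * 'X)
   - ((1 - th)%:P + 2%:P * 'X) * ((N + t)%:P + 2%:P * 'X) * (N + t)%:P.
pose p2 : {poly R} := ((1 - t)%:P - 2%:P * 'X) * ((N + th)%:P - 'X) * vs%:P * ((N - 1 + 2 * th)%:P - 3%:P * 'X)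
   - ((1 - th)%:P + 2%:P * 'X) * ((N + t)%:P + 2%:P * 'X) * (((N - 1) * (1 - mu))%:P + (N + 6)%:P * 'X).
pose p3 : {poly R} := ((N + th)%:P - 2%:P * 'X) * ((N - 2)%:P * (mu%:P - 'X) + (t + 2)%:P - 8%:P * 'X)
   - ((1 - th)%:P + 'X) * (vs%:P * ((N + th)%:P - 2%:P * 'X) + (N + t)%:P).
have [d1 d10 H1] : exists2 d, 0 < d & forall e, 0 < e -> e < d -> 0 < p1.[e].
  apply: horner_gt0_near0; rewrite /p1 !(hornerM, hornerD, hornerN, hornerC, hornerX).
  by move: vlo; rewrite /a /b !expr2; clear; lra.
have [d2 d20 H2] : exists2 d, 0 < d & forall e, 0 < e -> e < d -> 0 < p2.[e].
  apply: horner_gt0_near0; rewrite /p2 !(hornerM, hornerD, hornerN, hornerC, hornerX).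
  have nt0 : 0 < N + th by clear -n2 th0; lra.
  have k0 : 0 < N - 1 + 2 * th by clear -n2 th0; lra.
  rewrite -(pmulr_lgt0 _ nt0).
  have : 0 < (1 - t) * (N + th) ^+ 2 * vs * (N - 1 + 2 * th) -
     (1 - th) * (N + t) * ((N - 1) * (1 - mu) * (N + th)).
    rewrite -rel2.
    have := vlo; rewrite -(ltr_pM2r k0) /a /b !expr2; clear; lra.
  rewrite !expr2; clear; lra.
(* At 0 the relation [rel] reduces [p3] to [(N + th) (1 - mu - vs (1 - th))]. *)
have [d3 d30 H3] : exists2 d, 0 < d & forall e, 0 < e -> e < d -> 0 < p3.[e].
  apply: horner_gt0_near0; rewrite /p3 !(hornerM, hornerD, hornerN, hornerC, hornerX).
  have nt0 : 0 < N + th by clear -n2 th0; lra.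
  have := vhi; rewrite -(ltr_pM2r nt0); move: rel; clear; lra.
have [e [e0 [ed1 ed2 ed3] [eth et]]] : exists e,
    [/\ 0 < e, [/\ e < d1, e < d2 & e < d3] & 2 * e < th /\ t + 2 * e < 1].
  pose M := Num.min (Num.min d1 d2) (Num.min d3 (Num.min (th / 2) ((1 - t) / 2))).
  have m0 : 0 < M by rewrite /M !lt_min d10 d20 d30 !divr_gt0 //; clear -t1; lra.
  have m1 : M <= d1 by rewrite /M !ge_min lexx.
  have m2 : M <= d2 by rewrite /M !ge_min lexx orbT.
  have m3 : M <= d3 by rewrite /M !ge_min lexx orbT.
  have m4 : M <= th / 2 by rewrite /M !ge_min lexx !orbT.
  have m5 : M <= (1 - t) / 2 by rewrite /M !ge_min lexx !orbT.
  clearbody M; exists (M / 2).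
  by clear -m0 m1 m2 m3 m4 m5; split; [lra|split; lra|split; lra].
have c1 := H1 e e0 ed1; have c2 := H2 e e0 ed2; have c3 := H3 e e0 ed3.
rewrite /p1 !(hornerM, hornerD, hornerN, hornerC, hornerX) subr_gt0 in c1; rewrite /p2 !(hornerM, hornerD, hornerN, hornerC, hornerX) subr_gt0 in c2.
rewrite /p3 !(hornerM, hornerD, hornerN, hornerC, hornerX) subr_gt0 in c3.
have := core_eps n1 (E1 e e0) (E2 e e0) (E3 e e0) (E4 e e0) fn0 e0 eth tht et vs1 c1 c2.
by rewrite -/N; move: c3; clear; lra.
Qed.

End Limit.

(** * The threshold as the larger root of a quadratic in [mu] *)

(** Multiplied by [D^2], the core inequality becomes [(1 - t)(1 - mu) <= (1 + t + (N - 1) mu)^2],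
    that is [(N - 1)^2 mu^2 + b mu + t (t + 3) >= 0]. As [th <= t] keeps [mu] from lying left of the
    vertex, [mu] is at least the larger root. *)
Lemma mu_threshold (R : rcfType) (N t th mu : R) :
  2 <= N -> 0 <= t -> t <= 1 -> 0 <= th -> th <= t -> N * mu + t <= 0 ->
  N + 1 + 2 * t + (N - 1) * mu != 0 ->
  th = (1 - N) * (t + N * mu) / (N + 1 + 2 * t + (N - 1) * mu) ->
  (0 < th -> t < 1 ->
   (N - 1) * mu * (N + th) = - (N - 1) * t - th * (N + 1 + 2 * t) ->
   (1 - t) * (1 - mu) * (N + th) ^+ 2 <= (1 - th) ^+ 2 * (N + t) ^+ 2) ->
  ((3 - 2 * N) * t + 1 - 2 * N +
     Num.sqrt ((1 - t) * ((4 * N - 5) * t + 4 * N ^+ 2 - 4 * N + 1)))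
             / (2 * (N - 1) ^+ 2) <= mu.
Proof.
move=> N2 t0 t1 th0 tht mut D0 thE core.
set D := _ + _ in D0 thE; set Dl := _ * (_ * t + _ - _ + _).
have DE : D = N + 1 + 2 * t + (N - 1) * mu by [].
have thD : th * D = (1 - N) * (t + N * mu) by rewrite thE divfK.
have a0 : 0 < 2 * (N - 1) ^+ 2 by rewrite mulr_gt0 // exprn_gt0 //; lra.
pose b := (2 * N - 3) * t + 2 * N - 1.
have b0 : 0 < b.
  rewrite /b; have : 0 <= (2 * N - 3) * t by rewrite mulr_ge0 //; lra.
  lra.
have Dl0 : 0 <= Dl.
  rewrite /Dl mulr_ge0 //; first lra.
  have : 0 <= (4 * N - 5) * t by rewrite mulr_ge0 //; lra.
  have : 0 <= (2 * N - 1) ^+ 2 by exact: sqr_ge0.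
  rewrite !expr2; lra.
have DlE m : (2 * (N - 1) ^+ 2 * m + b) ^+ 2 - Dl =
   4 * (N - 1) ^+ 2 * ((N - 1) ^+ 2 * m ^+ 2 + b * m + t * (t + 3)).
  by rewrite /Dl /b; ring.
rewrite ler_pdivrMr //.
have -> : (3 - 2 * N) * t + 1 - 2 * N + Num.sqrt Dl = Num.sqrt Dl - b by rewrite /b; ring.
rewrite lerBlDr mulrC.
set x := _ + b.
suff [x0 Q0] : 0 <= x /\ (Dl = 0 \/ 0 <= (N - 1) ^+ 2 * mu ^+ 2 + b * mu + t * (t + 3)).
  rewrite -(ler_pXn2r (n := 2)) ?nnegrE ?sqrtr_ge0 // sqr_sqrtr // -subr_ge0.
  case: Q0 => [->|Q0]; first by rewrite subr0 exprn_ge0.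
  by rewrite DlE mulr_ge0 // mulr_ge0 // exprn_ge0 //; lra.
have [mu0|mu0] := eqVneq (N * mu + t) 0.
  have Nmu : N * mu = - t by lra.
  have N0 : 0 < N by lra.
  split.
    rewrite -(pmulr_rge0 _ N0).
    have -> : N * x = t * (N - 2) + N * (2 * N - 1).
      have -> : N * x = 2 * (N - 1) ^+ 2 * (N * mu) + N * b by rewrite /x; ring.
      by rewrite Nmu /b; ring.
    by rewrite addr_ge0 // mulr_ge0 //; lra.
  right; have N20 : 0 < N ^+ 2 by rewrite exprn_gt0.
  rewrite -(pmulr_rge0 _ N20).
  have -> : N ^+ 2 * ((N - 1) ^+ 2 * mu ^+ 2 + b * mu + t * (t + 3)) = t * (N + 1) * (t + N).
    have -> : N ^+ 2 * ((N - 1) ^+ 2 * mu ^+ 2 + b * mu + t * (t + 3)) =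
      (N - 1) ^+ 2 * (N * mu) ^+ 2 + b * N * (N * mu) + N ^+ 2 * (t * (t + 3)) by ring.
    by rewrite Nmu /b; ring.
  by rewrite !mulr_ge0 //; lra.
have num0 : 0 < (1 - N) * (t + N * mu).
  by rewrite -mulrNN mulr_gt0 //; [lra | move: mu0 mut; rewrite -subr_eq0; case: ltgtP => //; lra].
have thp : 0 < th.
  by rewrite lt_def th0 andbT; apply: contraTneq num0 => th00; rewrite -thD th00 mul0r ltxx.
have Dp : 0 < D by rewrite -(pmulr_rgt0 _ thp) thD.
(* This is [th <= t] multiplied by [D], after a factor [N + t] is removed. *)
have low : 0 <= 2 * t + (N - 1) * mu.
  have Nt : 0 < N + t by lra.
  rewrite -(pmulr_rge0 _ Nt).
  have := ler_wpM2r (ltW Dp) tht; rewrite thD DE; clear; lra.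
have x0 : 0 <= x.
  have N1 : 0 <= N - 1 by lra.
  have h1 := mulr_ge0 N1 low.
  have h2 : 0 <= (2 * N - 1) * (1 - t) by rewrite mulr_ge0 //; lra.
  have -> : x = 2 * ((N - 1) * (2 * t + (N - 1) * mu)) + (2 * N - 1) * (1 - t).
    by rewrite /x /b; ring.
  by rewrite addr_ge0 // mulr_ge0.
(* At [t = 1] the discriminant vanishes and [0 <= x] alone suffices. *)
split=> //; move: t1; rewrite le_eqVlt => /orP[/eqP t1|t1].
  by left; rewrite /Dl t1 subrr mul0r.
right; have rel : (N - 1) * mu * (N + th) = - (N - 1) * t - th * (N + 1 + 2 * t).
  by move: thD; rewrite DE; clear; lra.
have c := core thp t1 rel.
have e1 : (N + th) * D = (N + 1) * (N + t).
  by rewrite mulrDl thD DE; ring.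
have e2 : (1 - th) * D = (N + 1) * (1 + t + (N - 1) * mu).
  by rewrite mulrBl thD DE; ring.
have NN : 0 < ((N + 1) * (N + t)) ^+ 2 by rewrite exprn_gt0 // mulr_gt0 //; lra.
have D20 : 0 <= D ^+ 2 by rewrite exprn_ge0 // ltW.
have := ler_wpM2r D20 c.
have -> : (1 - t) * (1 - mu) * (N + th) ^+ 2 * D ^+ 2 =
   (1 - t) * (1 - mu) * ((N + 1) * (N + t)) ^+ 2 by rewrite -e1; ring.
have -> : (1 - th) ^+ 2 * (N + t) ^+ 2 * D ^+ 2 =
   (1 + t + (N - 1) * mu) ^+ 2 * ((N + 1) * (N + t)) ^+ 2.
  by rewrite mulrAC -exprMn e2; ring.
rewrite ler_pM2r // /b !expr2; clear; lra.
Qed.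

(** * Successive minima *)

Section Minima.
Variables (R : realType) (n : nat) (xi : 'I_n -> R).

Definition row_of (x : int) (y : 'I_n -> int) : 'rV[int]_(1 + n) :=
  row_mx x%:M (\row_i y i).

Lemma intvE (N : nat) (x : 'rV[int]_N) i j : intv R x i j = (x i j)%:~R.
Proof. by rewrite mxE. Qed.

Lemma row_of_surj (X : 'rV[int]_(1 + n)) :
  X = row_of (X 0 (lshift n 0)) (fun i => X 0 (rshift 1 i)).
Proof.
rewrite -[LHS]hsubmxK; congr row_mx; apply/rowP => i; rewrite !mxE //.
by rewrite ord1 eqxx.
Qed.

Lemma row_of0 x y : row_of x y 0 (lshift n 0) = x.
Proof. by rewrite row_mxEl mxE eqxx. Qed.

Lemma row_ofS x y i : row_of x y 0 (rshift 1 i) = y i.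
Proof. by rewrite row_mxEr mxE. Qed.

Lemma lin_indep_rows (j : nat) (x : 'I_j -> int) (y : 'I_j -> 'I_n -> int) :
  lin_indep (fun k => lattice_pt xi (x k) (y k)) <->
  (forall c : 'I_j -> R, \sum_k c k *: intv R (row_of (x k) (y k)) = 0 -> forall k, c k = 0).
Proof.
have E (c : 'I_j -> R) : \sum_k c k *: intv R (row_of (x k) (y k)) = 0 <->
    \sum_k c k * (x k)%:~R = 0 /\ forall i, \sum_k c k * (y k i)%:~R = 0.
  split=> [/rowP c0|[c1 c2]].
    split=> [|i].
      have := c0 (lshift n 0); rewrite summxE mxE => h; rewrite -[RHS]h.
      by apply: eq_bigr => k _; rewrite mxE intvE row_of0.
    have := c0 (rshift 1 i); rewrite summxE mxE => h; rewrite -[RHS]h.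
    by apply: eq_bigr => k _; rewrite mxE intvE row_ofS.
  apply/rowP => i; rewrite summxE [RHS]mxE; case: (split_ordP i) => {}i ->.
    rewrite ord1 -[RHS]c1; apply: eq_bigr => k _.
    by rewrite mxE intvE row_of0.
  by rewrite -[RHS](c2 i); apply: eq_bigr => k _; rewrite mxE intvE row_ofS.
have F (c : 'I_j -> R) i : \sum_k c k * (lattice_pt xi (x k) (y k)).2 i =
    xi i * (\sum_k c k * (x k)%:~R) - \sum_k c k * (y k i)%:~R.
  rewrite mulr_sumr -sumrB; apply: eq_bigr => k _ /=.
  by rewrite mulrBr mulrCA.
split=> H c.
  move/E => [c1 c2]; apply: H => // i.
  by rewrite F c1 c2 mulr0 subrr.
move=> c1 c2; apply: H; apply/E; split=> // i.
have := c2 i; rewrite F.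
have -> : \sum_k c k * (x k)%:~R = 0 by exact: c1.
by rewrite mulr0 sub0r => /eqP; rewrite oppr_eq0 => /eqP.
Qed.

Lemma in_box_primal (q l : R) x y : in_box q l (lattice_pt xi x y) <->
  (expR (- (n%:R * q)) * `|x%:~R| <= l /\
   forall i, expR q * `|xi i * x%:~R - (y i)%:~R| <= l).
Proof.
rewrite /in_box /=; split=> -[h1 h2]; split=> [|i].
- by rewrite expRN mulrC ler_pdivrMr ?expR_gt0.
- by have := h2 i; rewrite expRN ler_pdivlMr ?expR_gt0 // mulrC.
- by move: h1; rewrite expRN mulrC ler_pdivrMr ?expR_gt0.
- by have := h2 i; rewrite expRN ler_pdivlMr ?expR_gt0 // mulrC.
Qed.

Lemma primal_nrm1_row q x y : nrm1 (intv R (row_of x y) *m primal_mx xi q) =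
  expR (- (n%:R * q)) * `|x%:~R : R| + \sum_i expR q * `|xi i * x%:~R - (y i)%:~R|.
Proof.
rewrite primal_nrm1 intvE row_of0; congr (_ + _).
by apply: eq_bigr => i _; rewrite intvE row_ofS.
Qed.

Lemma in_box_of_nrm1 q l x y :
  nrm1 (intv R (row_of x y) *m primal_mx xi q) <= l -> in_box q l (lattice_pt xi x y).
Proof.
rewrite primal_nrm1_row => h; apply/in_box_primal.
have pos i : 0 <= expR q * `|xi i * x%:~R - (y i)%:~R| by rewrite mulr_ge0 ?expR_ge0.
split=> [|i]; apply: le_trans h.
  by rewrite lerDl sumr_ge0.
by rewrite (bigD1 i) //= addrCA lerDl addr_ge0 ?sumr_ge0 // mulr_ge0 ?expR_ge0.
Qed.

Lemma nrm1_of_in_box q l x y :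
  in_box q l (lattice_pt xi x y) ->
  nrm1 (intv R (row_of x y) *m primal_mx xi q) <= (1 + n)%:R * l.
Proof.
move=> /in_box_primal[h1 h2]; rewrite primal_nrm1_row natrD mulrDl mul1r.
apply: lerD => //; apply: le_trans (ler_sum _ (fun i _ => h2 i)) _.
by rewrite sumr_const card_ord mulr_natl.
Qed.

Lemma succ_min_le q j l : 0 < l ->
  (exists (x : 'I_j -> int) (y : 'I_j -> 'I_n -> int),
     lin_indep (fun k => lattice_pt xi (x k) (y k)) /\
     forall k, in_box q l (lattice_pt xi (x k) (y k))) ->
  succ_min xi q j <= l.
Proof.
move=> l0 H; apply: ge_inf; first by exists 0 => l' [/ltW].
by split.
Qed.

Lemma primal_unit q : primal_mx xi q \in unitmx.
Proof. by rewrite unitmxE unitfE -normr_eq0 primal_det oner_eq0. Qed.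

(** [inf] carries information only for a nonempty set bounded below: [j] unit vectors give a member,
    discreteness of the lattice a positive lower bound. *)
Lemma succ_min_gt0_lt q j : (0 < j <= 1 + n)%N ->
  0 < succ_min xi q j /\ forall B, succ_min xi q j < B ->
  exists2 l, 0 < l < B & exists (x : 'I_j -> int) (y : 'I_j -> 'I_n -> int),
     lin_indep (fun k => lattice_pt xi (x k) (y k)) /\
     forall k, in_box q l (lattice_pt xi (x k) (y k)).
Proof.
move=> /andP[j0 jn].
have [c c0 Hc] := lattice_discrete (primal_unit q).
set S := [set l : R | 0 < l /\ exists (x : 'I_j -> int) (y : 'I_j -> 'I_n -> int),
     lin_indep (fun k => lattice_pt xi (x k) (y k)) /\
     forall k, in_box q l (lattice_pt xi (x k) (y k))]%classic.
have SE : succ_min xi q j = inf S by [].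
have N0 : 0 < (1 + n)%:R :> R by rewrite ltr0n.
have S0 : (S !=set0)%classic.
  pose E (k : 'I_j) : 'rV[int]_(1 + n) := delta_mx 0 (widen_ord jn k).
  exists (1 + \sum_k nrm1 (intv R (E k) *m primal_mx xi q)); split.
    by rewrite ltr_wpDr // sumr_ge0 // => k _; exact: nrm1_ge0.
  exists (fun k => E k 0 (lshift n 0)), (fun k i => E k 0 (rshift 1 i)); split.
    apply/lin_indep_rows => a a0 k.
    move/rowP/(_ (widen_ord jn k)): a0; rewrite summxE [RHS]mxE (bigD1 k) //= big1.
      by rewrite -row_of_surj !mxE !eqxx mulr1 addr0.
    move=> k' k'k; rewrite -row_of_surj !mxE eqxx /=.
    have -> : (widen_ord jn k == widen_ord jn k') = (k == k') by [].
    by rewrite eq_sym (negPf k'k) mulr0.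
  move=> k; apply: in_box_of_nrm1; rewrite -row_of_surj (bigD1 k) //= addrCA lerDl.
  by rewrite addr_ge0 // sumr_ge0 // => i _; exact: nrm1_ge0.
have Slb l : S l -> c / (1 + n)%:R <= l.
  move=> [l0 [x [y [/lin_indep_rows xy xyl]]]].
  rewrite ler_pdivrMr // mulrC.
  apply: le_trans (nrm1_of_in_box (xyl (Ordinal j0))); apply: Hc.
  apply/eqP => r0.
  have h0 : \sum_k (k == Ordinal j0)%:R *: intv R (row_of (x k) (y k)) = 0.
    rewrite big1 // => k _; case: eqVneq => [->|_]; last by rewrite scale0r.
    by rewrite r0 intv0 scaler0.
  by have /eqP := xy _ h0 (Ordinal j0); rewrite eqxx oner_eq0.
have infc : c / (1 + n)%:R <= inf S by apply: lb_le_inf.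
split; first by rewrite SE; apply: lt_le_trans infc; rewrite divr_gt0.
move=> B; rewrite SE => SB.
have [l [l0 Sl] lB] : exists2 l, S l & l < inf S + (B - inf S).
  by apply: inf_adherent; [rewrite subr_gt0 | split=> //; exists (c / (1 + n)%:R)].
by exists l => //; rewrite l0 /=; move: lB; rewrite addrC subrK.
Qed.

Lemma succ_min_transference : exists2 C : R, 0 < C & forall q A, 0 < A ->
  A < succ_min xi q n.+1 ->
  exists2 y : 'rV[int]_(1 + n), y != 0 & nrm1 (intv R y *m dual_mx xi q) <= C / A.
Proof.
have [C C0 HC] := @transference R (1 + n) isT; exists C => // q A A0 Amin.
apply: (HC _ _ _ (primal_dual xi q) (primal_det xi q) (dual_det xi q) A0) => X sX fX.
apply: contrapT => H; move: Amin; rewrite ltNge => /negP; apply.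
apply: succ_min_le => //.
pose E (k : 'I_n.+1) : 'rV[int]_(1 + n) := nth 0 X k.
exists (fun k => E k 0 (lshift n 0)), (fun k i => E k 0 (rshift 1 i)); split; last first.
  move=> k; apply: in_box_of_nrm1; rewrite -row_of_surj leNgt; apply/negP => kA.
  by apply: H; exists (E k) => //; rewrite mem_nth // sX.
apply/lin_indep_rows => a a0.
have sX' : size [seq intv R x *m primal_mx xi q | x <- X] == n.+1 by rewrite size_map sX.
have /freeP := fX : free (Tuple sX').
apply; rewrite -[RHS](mul0mx _ (primal_mx xi q)) -[X in _ = X *m _]a0 mulmx_suml.
apply: eq_bigr => k _.
by rewrite -row_of_surj -scalemxAl /= (nth_map 0) // sX; exact: ltn_ord.
Qed.

(** Of [n + 1] independent integer vectors one is not orthogonal to [y]; their product is a nonzero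
    integer and, by duality, at most the product of the two norms. *)
Lemma succ_min_dual_lower q B (y : 'rV[int]_(1 + n)) : succ_min xi q n.+1 < B -> y != 0 ->
  1 <= (1 + n)%:R * B * nrm1 (intv R y *m dual_mx xi q).
Proof.
have [_ H] := @succ_min_gt0_lt q n.+1 (leqnn _).
move=> /H[l /andP[l0 lB] [x [z [/lin_indep_rows xz xzl]]]] y0.
pose M : 'M[R]_(1 + n) := \matrix_k intv R (row_of (x k) (z k)).
have Mu : M \in unitmx.
  rewrite -row_free_unit -kermx_eq0; apply/eqP/row_matrixP => i; rewrite row0.
  set c := row i _; have cM : c *m M = 0 by rewrite /c -row_mul mulmx_ker row0.
  apply/rowP => k; rewrite [RHS]mxE; apply: (xz (fun k => c 0 k)).
  by rewrite -[RHS]cM mulmx_sum_row; apply: eq_bigr => k' _; rewrite rowK.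
have [k yk] : exists k, dotv (intv R (row_of (x k) (z k))) (intv R y) != 0.
  apply: contrapT => Hk; move/eqP: y0; apply; apply/eqP; rewrite -(intv_eq0 R).
  have yM : intv R y *m M^T = 0.
    apply/rowP => k; rewrite [RHS]mxE; apply/eqP/negPn/negP => h; apply: Hk; exists k.
    suff <- : (intv R y *m M^T) 0 k = dotv (intv R (row_of (x k) (z k))) (intv R y) by [].
    rewrite /dotv mxE [RHS]mxE; apply: eq_bigr => i _.
    by rewrite [M^T _ _]mxE [M _ _]mxE [(intv R y)^T _ _]mxE mulrC.
  have Mtu : M^T \in unitmx by rewrite unitmx_tr.
  by apply/eqP; rewrite -[LHS](mulmxK Mtu) yM mul0mx.
have : 1 <= `|dotv (intv R (row_of (x k) (z k))) (intv R y)|.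
  move: yk; rewrite intv_dot -intr_norm ler1z -gtz0_ge1 normr_gt0.
  by apply: contra_neq => ->.
move=> /le_trans; apply.
rewrite -(dot_dual _ _ (primal_dual xi q)); apply: le_trans (dot_le _ _) _.
apply: ler_wpM2r; first exact: nrm1_ge0.
apply: le_trans (nrm1_of_in_box (xzl k)) _.
by rewrite ler_wpM2l ?ler0n // ltW.
Qed.

Lemma succ_min1_lower q A (x : 'rV[int]_(1 + n)) : 0 < A -> A < succ_min xi q 1 -> x != 0 ->
  A <= nrm1 (intv R x *m primal_mx xi q).
Proof.
move=> A0 Amin x0; rewrite leNgt; apply/negP => xA.
move: Amin; rewrite ltNge => /negP; apply; apply: succ_min_le => //.
exists (fun=> x 0 (lshift n 0)), (fun _ i => x 0 (rshift 1 i)); split; last first.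
  by move=> _; apply: in_box_of_nrm1; rewrite -row_of_surj ltW.
apply/lin_indep_rows => c; rewrite big_ord1 -row_of_surj => /eqP.
rewrite scaler_eq0 intv_eq0 (negPf x0) orbF => /eqP c0 k.
by rewrite ord1.
Qed.

(** * Limits of [phi] as exponential bounds on the two lattices *)

Lemma phi_gt j q a : (0 < j <= 1 + n)%N -> 0 < q -> a < phi xi j q ->
  expR (a * q) < succ_min xi q j.
Proof.
move=> jn q0; have [s0 _] := @succ_min_gt0_lt q j jn.
by rewrite /phi ltr_pdivlMr // -[X in _ -> _ < X]lnK ?posrE // ltr_expR.
Qed.

Lemma phi_lt j q a : (0 < j <= 1 + n)%N -> 0 < q -> phi xi j q < a ->
  succ_min xi q j < expR (a * q).
Proof.
move=> jn q0; have [s0 _] := @succ_min_gt0_lt q j jn.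
by rewrite /phi ltr_pdivrMr // -[X in _ -> X < _]lnK ?posrE // ltr_expR.
Qed.

Lemma exp_absorbs (C e : R) : 0 < e -> exists2 Q, 0 <= Q & forall q, Q < q -> C <= expR (e * q).
Proof.
move=> e0; exists (`|C| / e); first by rewrite divr_ge0 // ltW.
move=> q; rewrite ltr_pdivrMr // => h; apply: le_trans (expR_ge1Dx _).
by have := ler_norm C; lra.
Qed.

(** Half of [e] is spent on the limit, the other half absorbs the transference constant. *)
Lemma liminf_good th e : 0 < e -> is_liminf_pinfty (phi xi n.+1) th ->
  exists Q, forall q, Q < q -> exists y, good xi (th - e) q y.
Proof.
move=> e0 [H _]; have [C C0 HC] := succ_min_transference.
have e20 : 0 < e / 2 by lra.
have [Q HQ] := H _ e20; have [Q' Q'0 HQ'] := exp_absorbs C e20.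
exists (Num.max Q Q') => q; rewrite gt_max => /andP[Qq Q'q].
have q0 : 0 < q := le_lt_trans Q'0 Q'q.
have h := phi_gt (leqnn _ : (0 < n.+1 <= 1 + n)%N) q0 (HQ q Qq).
have [y y0 yC] := HC q _ (expR_gt0 _) h.
exists y; split=> //; apply: le_trans yC _.
rewrite ler_pdivrMr ?expR_gt0 // -expRD; apply: le_trans (HQ' q Q'q) _.
by rewrite ler_expR; lra.
Qed.

Lemma limsup_good t e : 0 < e -> is_limsup_pinfty (phi xi n.+1) t ->
  forall Q, exists2 p, Q < p & exists y, good xi (t - e) p y.
Proof.
move=> e0 [_ H] Q; have [C C0 HC] := succ_min_transference.
have e20 : 0 < e / 2 by lra.
have [Q' Q'0 HQ'] := exp_absorbs C e20.
have [q [Qq tq]] := H _ e20 (Num.max Q Q').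
move: Qq; rewrite gt_max => /andP[Qq Q'q].
have q0 : 0 < q := le_lt_trans Q'0 Q'q.
have h := phi_gt (leqnn _ : (0 < n.+1 <= 1 + n)%N) q0 tq.
have [y y0 yC] := HC q _ (expR_gt0 _) h.
exists q => //; exists y; split=> //; apply: le_trans yC _.
rewrite ler_pdivrMr ?expR_gt0 // -expRD; apply: le_trans (HQ' q Q'q) _.
by rewrite ler_expR; lra.
Qed.

Lemma limsup_dual_lower t e : 0 < e -> is_limsup_pinfty (phi xi n.+1) t ->
  exists Q, forall q, Q < q -> forall y : 'rV[int]_(1 + n), y != 0 ->
    expR (- ((t + e) * q)) <= nrm1 (intv R y *m dual_mx xi q).
Proof.
move=> e0 [H _].
have e20 : 0 < e / 2 by lra.
have [Q HQ] := H _ e20; have [Q' Q'0 HQ'] := exp_absorbs (1 + n)%:R e20.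
exists (Num.max Q Q') => q; rewrite gt_max => /andP[Qq Q'q] y y0.
have q0 : 0 < q := le_lt_trans Q'0 Q'q.
have h := phi_lt (leqnn _ : (0 < n.+1 <= 1 + n)%N) q0 (HQ q Qq).
have h1 := succ_min_dual_lower h y0.
rewrite -(ler_pM2l (expR_gt0 ((t + e) * q))) -expRD subrr expR0.
apply: le_trans h1 _; apply: ler_wpM2r; first exact: nrm1_ge0.
apply: le_trans (ler_wpM2r (expR_ge0 _) (HQ' q Q'q)) _.
by rewrite -expRD ler_expR; lra.
Qed.

Lemma liminf_primal_lower mu e : 0 < e -> is_liminf_pinfty (phi xi 1) mu ->
  exists Q, forall q, Q < q -> forall x : 'rV[int]_(1 + n), x != 0 ->
    expR ((mu - e) * q) <= nrm1 (intv R x *m primal_mx xi q).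
Proof.
move=> e0 [H _]; have [Q HQ] := H _ e0.
exists (Num.max Q 0) => q; rewrite gt_max => /andP[Qq q0] x x0.
apply: succ_min1_lower x0; first exact: expR_gt0.
by apply: phi_gt => //; exact: HQ.
Qed.

(** Minkowski supplies at every time a nonzero dual vector of bounded norm, which keeps the last
    minimum away from 0; a negative lower limit would let it decay. *)
Lemma liminf_ge0 th : is_liminf_pinfty (phi xi n.+1) th -> 0 <= th.
Proof.
move=> [_ H]; rewrite leNgt; apply/negP => th0.
have e0 : 0 < - th / 2 by lra.
pose N : R := (1 + n)%:R.
have N1 : 1 <= N by rewrite /N ler1n.
have [Q Q0 HQ] := exp_absorbs (1 + N * (N * 4)) e0.
have [q [Qq hq]] := H _ e0 Q.
have q0 : 0 < q := le_lt_trans Q0 Qq.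
have h := phi_lt (leqnn _ : (0 < n.+1 <= 1 + n)%N) q0 hq.
have Hu : dual_mx xi q \in unitmx by rewrite unitmxE unitfE -normr_eq0 dual_det oner_eq0.
(* Halving makes the determinant strictly smaller than 1, and turns the bound 2 into 4. *)
have [||y y0 yH] := @linear_forms_short R (1 + n) (2^-1 *: dual_mx xi q).
- by rewrite unitmxZ // unitfE invr_eq0.
- rewrite detZ normrM dual_det mulr1 ger0_norm ?exprn_ge0 ?invr_ge0 //.
  by rewrite exprn_ilt1 // ?invr_ge0 ?invf_lt1 //; lra.
have yN : nrm1 (intv R y *m dual_mx xi q) <= N * 4.
  apply: nrm1_le => j; have := yH j; rewrite -scalemxAr mxE normrM.
  by rewrite gtr0_norm ?invr_gt0 // mulrC ler_pdivrMr //; lra.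
have h1 := succ_min_dual_lower h y0; rewrite -/N in h1.
have B0 := expR_gt0 ((th + - th / 2) * q).
have h2 : 1 <= N * expR ((th + - th / 2) * q) * (N * 4).
  apply: le_trans h1 _; apply: ler_wpM2l yN; apply: mulr_ge0; lra.
have h3 : expR ((th + - th / 2) * q) * expR (- th / 2 * q) = 1.
  by rewrite -expRD -[RHS]expR0; congr expR; field.
have := HQ q Qq; rewrite -(ler_pM2l B0) h3; lra.
Qed.

Lemma lform_neq0 : Q_lin_indep xi ->
  forall y : 'rV[int]_(1 + n), y != 0 -> lform xi (intv R y) != 0.
Proof.
move=> Qi y; apply: contra_neq => y0.
have [|a0 a1] := Qi (y 0 (lshift n 0))%:~R (fun i => (y 0 (rshift 1 i))%:~R).
  rewrite ratr_int -[RHS]y0 /lform intvE; congr (_ + _).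
  by apply: eq_bigr => i _; rewrite ratr_int intvE mulrC.
apply/rowP => j; rewrite [RHS]mxE; case: (split_ordP j) => i ->.
  by rewrite ord1; apply/eqP; rewrite -(intr_eq0 rat) a0.
by apply/eqP; rewrite -(intr_eq0 rat) a1.
Qed.

Lemma le0_of_le_eps (a K : R) : (forall e, 0 < e -> a <= K * e) -> a <= 0.
Proof.
move=> H; rewrite leNgt; apply/negP => a0.
have K0 : 0 < 1 + `|K| by have := normr_ge0 K; lra.
have := H (a / (2 * (1 + `|K|))); rewrite divr_gt0 ?mulr_gt0 // => /(_ isT).
rewrite mulrA ler_pdivlMr ?mulr_gt0 // mulrC => h.
have := mulr_ge0 (normr_ge0 K) (ltW a0).
have := ler_wpM2r (ltW a0) (ler_norm K); lra.
Qed.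

Lemma peak_bound t mu : (0 < n)%N ->
  is_limsup_pinfty (phi xi n.+1) t -> is_liminf_pinfty (phi xi 1) mu ->
  n%:R * mu + t <= 0.
Proof.
move=> n0 Ht Hmu; apply: (@le0_of_le_eps _ (n%:R + 2)) => e e0.
have [Q4 E4] := liminf_primal_lower e0 Hmu.
have [Q Q0 HQ] := exp_absorbs (64 * (32 * (1 + n)%:R ^+ 2) ^+ (1 + n)) e0.
have [p] := limsup_good e0 Ht (Num.max Q4 Q).
rewrite gt_max => /andP[Q4p Qp] [y [y0 yp]].
have p0 : 0 < p := le_lt_trans Q0 Qp.
have fy : free [seq intv R x | x <- [:: y]] by rewrite /= seq1_free intv_eq0.
have := @prod_lower R _ _ _ [:: y] _ (primal_dual xi p) (primal_det xi p) isT isT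
   (expR_gt0 _) (E4 p Q4p) fy.
rewrite !big_cons big_nil mulr1 /= -expRM_natl addKn => h.
have h2 : expR (n%:R * ((mu - e) * p)) <= expR (e * p) * expR (- ((t - e) * p)).
  apply: le_trans h _; apply: ler_pM (HQ p Qp) yp; last exact: nrm1_ge0.
  by rewrite mulr_ge0 // exprn_ge0 // mulr_ge0 // exprn_ge0.
move: h2; rewrite -expRD ler_expR => h2.
by rewrite -(ler_pM2r p0); clear -h2; lra.
Qed.

Lemma liminf_le_limsup th t :
  is_liminf_pinfty (phi xi n.+1) th -> is_limsup_pinfty (phi xi n.+1) t -> th <= t.
Proof.
move=> [H1 _] [H2 _]; rewrite -subr_le0; apply: (@le0_of_le_eps _ 2) => e e0.
have [Q1 h1] := H1 e e0; have [Q2 h2] := H2 e e0.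
pose q := 1 + Num.max Q1 Q2.
have q1 : Q1 < q by rewrite /q ltr_pwDl // le_max lexx.
have q2 : Q2 < q by rewrite /q ltr_pwDl // le_max lexx orbT.
have := h1 q q1; have := h2 q q2; lra.
Qed.

End Minima.

Unset Implicit Arguments.
Set Strict Implicit.

Theorem theorem5p3 (R : realType) (n : nat) (t mu : R) :
  (2 <= n)%N -> 0 <= t <= 1 ->
  let mu0 := ((3 - 2 * n%:R) * t + 1 - 2 * n%:R +
              Num.sqrt ((1 - t) * ((4 * n%:R - 5) * t + 4 * n%:R ^+ 2 - 4 * n%:R + 1)))
             / (2 * (n%:R - 1) ^+ 2) in
  (mu < mu0 \/ - t / n%:R < mu) ->
  n%:R + 1 + 2 * t + (n%:R - 1) * mu != 0 ->
  ~ exists xi : 'I_n -> R,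
      Q_lin_indep xi /\
      is_limsup_pinfty (phi xi n.+1) t /\
      is_liminf_pinfty (phi xi n.+1)
        ((1 - n%:R) * (t + n%:R * mu) / (n%:R + 1 + 2 * t + (n%:R - 1) * mu)) /\
      is_liminf_pinfty (phi xi 1) mu.
Proof.
move=> n2 /andP[t0 t1] mu0 hmu D0 [xi [Qi [Ht [Hth Hmu]]]].
have mut := peak_bound (ltnW n2) Ht Hmu.
have N2 : 2 <= n%:R :> R by rewrite (ler_nat R 2 n).
case: hmu => [mulow|muhigh]; last first.
  by move: muhigh; rewrite ltr_pdivrMr; lra.
move: mulow; rewrite ltNge => /negP; apply.
set th := _ / _ in Hth.
apply: (@mu_threshold R n%:R t th mu N2 t0 t1 _ _ mut D0 (erefl _)).
- exact: liminf_ge0 Hth.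
- exact: liminf_le_limsup Hth Ht.
move=> thp tlt rel.
apply: (core_limit n2 _ _ _ _ (lform_neq0 Qi) thp _ tlt rel).
- by move=> e e0; exact: liminf_good.
- by move=> e e0; exact: limsup_dual_lower.
- by move=> e e0; exact: limsup_good.
- by move=> e e0; exact: liminf_primal_lower.
- exact: liminf_le_limsup Hth Ht.
Qed.
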